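(* Fix $\varepsilon\in(0,1)$. Then there exists a constant $C(\varepsilon)\in(0,\infty)$ such that for all $d\in\mathbb{N}$ and $p\in[2,\infty)$ we have $$\|\mathcal{S}^d_{*,(0,d^{1-\varepsilon}]}f\|_{\ell^p(\mathbb{Z}^d)}\le C(\varepsilon)\,\|f\|_{\ell^p(\mathbb{Z}^d)},\qquad f\in\ell^p(\mathbb{Z}^d).$$ Thus, for all $d\in\mathbb{N}$ and $p\in[2,\infty)$ we also have $$\|M^d_{*,(0,d^{1-\varepsilon}]}f\|_{\ell^p(\mathbb{Z}^d)}\le C(\varepsilon)\,\|f\|_{\ell^p(\mathbb{Z}^d)},\qquad f\in\ell^p(\mathbb{Z}^d).$$
   Context: $\mathbb{N}=\{1,2,\dots\}$. For $R\ge0$ let $B_R^d=\{x\in\mathbb{R}^d:|x_1|+\dots+|x_d|\le R\}$ and $S_R^d=\{x\in\mathbb{R}^d:|x_1|+\dots+|x_d|=R\}$. For $f:\mathbb{Z}^d\to\mathbb{R}$ and $x\in\mathbb{Z}^d$ put $M_R^df(x)=\frac{1}{|B_R^d\cap\mathbb{Z}^d|}\sum_{y\in B_R^d\cap\mathbb{Z}^d}f(x-y)$, and, for nonnegative integers $R$, $\mathcal{S}_R^df(x)=\frac{1}{|S_R^d\cap\mathbb{Z}^d|}\sum_{y\in S_R^d\cap\mathbb{Z}^d}f(x-y)$, where $|\cdot|$ of a finite set is its cardinality. For $E\subseteq[0,\infty)$ let $M^d_{*,E}f(x)=\sup_{R\in E}|M_R^df(x)|$ and $\mathcal{S}^d_{*,E}f(x)=\sup_{R\in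 E\cap\mathbb{Z}}|\mathcal{S}_R^df(x)|$. *)

(* Defs.v *)
From HB Require Import structures.
From mathcomp Require Import all_boot all_order all_algebra.
From mathcomp Require Import finmap.
From mathcomp Require Import all_classical all_reals all_analysis.

Set Implicit Arguments.
Unset Strict Implicit.
Unset Printing Implicit Defensive.
Import Order.TTheory GRing.Theory Num.Theory.

Local Open Scope classical_set_scope.
Local Open Scope ring_scope.

Section Averages.
Context {R : realType} {d : nat}.

Definition l1norm (x : 'rV[R]_d) : R := \sum_(i < d) `|x ord0 i|.

Definition l1ball (r : R) : set 'rV[R]_d := [set x | l1norm x <= r].

Definition l1sphere (r : R) : set 'rV[R]_d := [set x | l1norm x = r].

(* A `&` Z^d, as a set of integer vectors *)
Definition lattice_points (A : set 'rV[R]_d) : set 'rV[int]_d :=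
  [set y | A (map_mx intr y)].

(* Meaningful when A contains finitely many (and at least one) lattice points:
   [fset_set] and [\sum_(_ \in _)] return default values on infinite sets. *)
Definition average (A : set 'rV[R]_d) (f : 'rV[int]_d -> R) (x : 'rV[int]_d)
    : R :=
  (#|` fset_set (lattice_points A)|%:R)^-1 *
  \sum_(y \in lattice_points A) f (x - y).

Definition ball_average (r : R) := average (l1ball r).

Definition sphere_average (n : nat) := average (l1sphere n%:R).

(* The supremum over an empty set of radii is -oo, not 0. *)
Definition ball_maximal (E : set R) (f : 'rV[int]_d -> R) (x : 'rV[int]_d)
    : \bar R :=
  ereal_sup [set `|ball_average r f x|%:E | r in E].

(* Ranging over n : nat is ranging over E `&` Z, for E included in [0, +oo[. *)
Definition sphere_maximal (E : set R) (f : 'rV[int]_d -> R) (x : 'rV[int]_d)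
    : \bar R :=
  ereal_sup [set `|sphere_average n f x|%:E | n in [set n : nat | E n%:R]].

Definition lpnorm (p : R) (f : 'rV[int]_d -> \bar R) : \bar R :=
  poweR (\esum_(x in [set: 'rV[int]_d]) poweR `|f x|%E p) p^-1.

End Averages.

(* Main.v *)
Require Import Defs.
From mathcomp Require Import all_boot all_order all_algebra.
From mathcomp Require Import finmap.
From mathcomp Require Import all_classical all_reals all_analysis.
From mathcomp Require Import ring lra zify.

(** By Jensen's inequality for the averages it is enough to treat p = 2, and
    ball averages are convex combinations of sphere averages. If d is bounded in
    terms of eps then so is the number of radii, and the triangle inequality
    suffices. Otherwise every radius n is at most d / 500. After transference to
    the torus (Z/N)^d let m_n be the multiplier of the sphere average S_n at the
    frequency theta, lambda = m_1 the mean of the cos theta_i, w = 1 - |lambda|.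
    The logarithmic derivative of the generating function
    prod_i (1 - q^2) / (1 - 2 q cos theta_i + q^2) gives a recurrence for m_n in
    which, as n <= d / 500, the weights decay geometrically. By induction
    |m_n| <= (1 - w/2)^n, |m_(n+2) - m_n| <= 4 w (1 - w/2)^n and
    |m_n - lambda^n| <= n w (1 - w/2)^n, so that by Plancherel the square
    functions with squares sum_n n |S_(n+2) f - S_n f|^2 and
    sum_n |S_n f - S_1^n f|^2 / n are bounded on l^2. By summation by parts and
    Cauchy-Schwarz they reduce the maximal function of the S_n f to that of the
    Cesaro means of the powers of the symmetric Markov operator S_1, which a TT^*
    argument bounds. *)

Set Implicit Arguments.
Unset Strict Implicit.
Unset Printing Implicit Defensive.
Import Order.TTheory GRing.Theory Num.Theory.

Local Open Scope classical_set_scope.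
Local Open Scope ring_scope.


(** * Decay of the multipliers from their recurrence *)

(** The factor [8 ^+ k] is what the inductions below lose at lag k: [4 ^+ k] bounds k^2, and
    [2 ^+ k] pays for shifting the exponent of [rho] by k. The decay of the weights absorbs it. *)
Lemma sum_geom_tail (R : realFieldType) n :
  \sum_(2 <= k < n.+1) 8 ^+ k * (1000^-1) ^+ k.-1 <= 8^-1 :> R.
Proof.
have E : forall j, \sum_(2 <= k < j.+2) 8 ^+ k * (1000^-1) ^+ k.-1
    = 8 / 124 * (1 - (125^-1) ^+ j) :> R.
  elim=> [|j IH]; first by rewrite big_geq // expr0 subrr mulr0.
  rewrite big_nat_recr //= IH.
  have -> : 8 ^+ j.+2 * 1000^-1 ^+ j.+1 = 8 * (125^-1) ^+ j.+1 :> R.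
    by rewrite exprS -mulrA -exprMn; congr (_ * _ ^+ _); lra.
  by rewrite exprS; lra.
case: n => [|n]; first by rewrite big_geq //; lra.
by rewrite E; have : 0 <= 125^-1 ^+ n :> R; [rewrite exprn_ge0 // invr_ge0|lra].
Qed.

Lemma onem_expr_le (R : realFieldType) (r : R) k :
  0 <= r <= 1 -> 1 - r ^+ k <= k%:R * (1 - r).
Proof.
move=> /andP[r0 r1]; elim: k => [|k IH]; first by rewrite expr0 subrr mul0r.
have := exprn_ge0 k r0; have := exprn_ile1 k r0 r1.
rewrite exprS -natr1; nra.
Qed.

Lemma sqrn_le_exp4 k : (k ^ 2 <= 4 ^ k)%N.
Proof.
elim: k => // -[|k] IH //.
rewrite [(4 ^ k.+2)%N]expnS; apply: leq_trans (leq_mul (leqnn 4) IH).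
by rewrite -!mulnn; nia.
Qed.

(* With [s n] the number of lattice points of the sphere of radius n, the
   hypotheses hold for [W n k = 2 d s (n - k) / (n s n)], [m n] the multiplier of
   the n-th sphere average and [g k] the mean of the cos (k theta_i). *)
Section MultiplierDecay.
Context {R : realFieldType} (W : nat -> nat -> R) (g m : nat -> R).
Variables (M : nat) (w : R).
Hypotheses (w_ge0 : 0 <= w) (w_le1 : w <= 1).
Hypothesis m0 : m 0 = 1.
Hypothesis m_rec : forall n, (0 < n <= M)%N ->
  m n = \sum_(1 <= k < n.+1) W n k * (g k - (~~ odd k)%:R) * m (n - k).
Hypothesis W_odd : forall n, (0 < n <= M)%N ->
  \sum_(1 <= k < n.+1) W n k * (odd k)%:R = 1.
Hypothesis W_ge0 : forall n k, 0 <= W n k.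
Hypothesis W_le : forall n k, (0 < k)%N -> (k <= n <= M)%N ->
  W n k <= (1000^-1) ^+ k.-1.
Hypothesis g1 : `|g 1| = 1 - w.
Hypothesis g_le1 : forall k, `|g k| <= 1.
Hypothesis g_even : forall k, ~~ odd k -> `|g k - 1| <= k%:R ^+ 2 * w.
Hypothesis g_odd : forall k, odd k -> `|g k - g 1| <= k%:R ^+ 2 * w.

(** Halving w leaves slack against the one-step factor [|g 1| = 1 - w], and [rho >= 1 / 2] limits
    the cost of a shift by k to a factor 2^k. *)
Let rho := 1 - w / 2.

Let rho_ge : 2^-1 <= rho. Proof. by move: w_ge0 w_le1; rewrite /rho; lra. Qed.
Let rho_ge0 : 0 <= rho. Proof. by move: w_ge0 w_le1; rewrite /rho; lra. Qed.
Let rho_le1 : rho <= 1. Proof. by move: w_ge0; rewrite /rho; lra. Qed.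

Let rho_shift n k : (k <= n)%N -> rho ^+ (n - k) <= 2 ^+ k * rho ^+ n.
Proof.
have rh := rho_ge.
move=> kn; rewrite -{2}(subnK kn) exprD mulrCA ler_peMr ?exprn_ge0 //.
rewrite -exprMn exprn_ege1 //; lra.
Qed.

Let sqr_le4 k : k%:R ^+ 2 <= 4 ^+ k :> R.
Proof. by rewrite -!natrX ler_nat sqrn_le_exp4. Qed.

Let exp8 k : 8 ^+ k = 4 ^+ k * 2 ^+ k :> R.
Proof. by rewrite -exprMn; congr (_ ^+ _); lra. Qed.

Let sqr_shift n k : (k <= n)%N ->
  k%:R ^+ 2 * w * rho ^+ (n - k) <= w * 8 ^+ k * rho ^+ n.
Proof.
move=> kn; have -> : w * 8 ^+ k * rho ^+ n = 4 ^+ k * w * (2 ^+ k * rho ^+ n).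
  by rewrite exp8; ring.
apply: ler_pM (rho_shift kn); rewrite ?mulr_ge0 ?exprn_ge0 //.
by rewrite ler_wpM2r // sqr_le4.
Qed.

(** An odd lag k brings no factor w from [g k], so the shift itself may lose only a multiple of w:
    by Bernoulli's inequality 1 - rho^k <= k w / 2. *)
Let expr_shift n k : (0 < k <= n)%N ->
  rho ^+ (n - k) <= (1 + w * 8 ^+ k) * rho ^+ n.
Proof.
move=> /andP[k0 kn].
have k1 : k%:R <= k%:R ^+ 2 :> R by rewrite expr2 ler_peMr // ler1n.
have : rho ^+ (n - k) - rho ^+ n <= k%:R ^+ 2 * w * rho ^+ (n - k).
  rewrite -{2}(subnK kn) exprD -{1}[rho ^+ (_ - k)]mulr1 -mulrBr mulrC.
  rewrite ler_wpM2r ?exprn_ge0 //.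
  have := @onem_expr_le R rho k; rewrite rho_ge0 rho_le1 => /(_ isT) h.
  apply: le_trans h _; apply: ler_pM => //; first by rewrite subr_ge0.
  by move: w_ge0; rewrite /rho; lra.
by have := sqr_shift kn; rewrite mulrDl mul1r; lra.
Qed.

Let W_sum8 n : (0 < n <= M)%N -> \sum_(2 <= k < n.+1) W n k * 8 ^+ k <= 8^-1.
Proof.
move=> nM; apply: le_trans (sum_geom_tail R n); rewrite !big_nat.
apply: ler_sum => k kn; rewrite mulrC ler_wpM2l ?exprn_ge0 //.
by move: nM kn => /andP[n0 nM] /andP[k2 kn]; apply: W_le; [exact: ltnW|rewrite nM andbT].
Qed.

Let W1_ge n : (0 < n <= M)%N -> 3 / 4 <= W n 1.
Proof.
move=> nM; have := W_odd nM; rewrite big_ltn ?ltnS; last by case/andP: nM.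
rewrite mulr1 => E; have := W_sum8 nM.
have : \sum_(2 <= k < n.+1) W n k * (odd k)%:R
     <= \sum_(2 <= k < n.+1) W n k * 8 ^+ k.
  apply: ler_sum => k _; rewrite ler_wpM2l //.
  by apply: (@le_trans _ _ 1); [case: (odd k) => //=; lra | rewrite exprn_ege1 //; lra].
lra.
Qed.

(** Since 1 - w <= rho^2, the term k = 1 of the recurrence gains [W n 1 * w / 2], at least 3 w / 8.
    The terms with k >= 2 exceed their odd weights by at most w / 8 in total, and all the odd
    weights sum to 1. *)
Lemma multiplier_decay n : (n <= M)%N -> `|m n| <= rho ^+ n.
Proof.
have w0 := w_ge0.
elim/ltn_ind: n => -[_ _|n IH nM]; first by rewrite m0 normr1 expr0.
have nM' : (0 < n.+1 <= M)%N by [].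
rewrite m_rec //; apply: le_trans (ler_norm_sum _ _ _) _.
rewrite big_ltn // subSS subn0 /= subr0.
have r0 := exprn_ge0 n.+1 rho_ge0.
have T1 : `|W n.+1 1 * g 1 * m n| <= W n.+1 1 * (1 - w / 2) * rho ^+ n.+1.
  rewrite !normrM g1 (ger0_norm (W_ge0 _ _)) -!mulrA ler_wpM2l //.
  apply: (@le_trans _ _ ((1 - w) * rho ^+ n)).
    by rewrite ler_wpM2l ?subr_ge0 // IH // ltnW.
  rewrite exprS mulrA ler_wpM2r ?exprn_ge0 //.
  by have := sqr_ge0 w; rewrite /rho; lra.
have T2 : \sum_(2 <= k < n.+2)
      `|W n.+1 k * (g k - (~~ odd k)%:R) * m (n.+1 - k)|
    <= \sum_(2 <= k < n.+2) (W n.+1 k * (odd k)%:R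
          + w * (W n.+1 k * 8 ^+ k)) * rho ^+ n.+1.
  rewrite !big_nat; apply: ler_sum => k /andP[k2 kn].
  rewrite !normrM (ger0_norm (W_ge0 _ _)) -!mulrA.
  rewrite [w * _]mulrCA -mulrDr -mulrA ler_wpM2l //.
  have IHk : `|m (n.+1 - k)| <= rho ^+ (n.+1 - k).
    by rewrite IH ?(leq_trans (leq_subr _ _)) // ltn_subrL (ltnW k2).
  apply: le_trans (ler_wpM2l (normr_ge0 _) IHk) _.
  have [ko|ke] := boolP (odd k) => /=.
    rewrite subr0; apply: (@le_trans _ _ (rho ^+ (n.+1 - k))).
      by rewrite ler_piMl ?exprn_ge0.
    by apply: expr_shift; rewrite (ltnW k2).
  rewrite add0r; apply: le_trans (sqr_shift _) => //.
  by rewrite ler_wpM2r ?exprn_ge0 // g_even.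
apply: le_trans (lerD T1 T2) _.
rewrite -big_distrl /= -mulrDl ler_piMl // big_split /= -mulr_sumr.
have := W_odd nM'; rewrite [in X in X -> _]big_ltn //= mulr1.
have := W_sum8 nM'; have := W1_ge nM'; move: w0.
set A := W _ _; set B := \sum_(_ <= _ < _) _; set C := \sum_(_ <= _ < _) _.
move=> {T1 T2} {}w0 hA hB hC.
have : w * B <= w * 8^-1 by rewrite ler_wpM2l.
have : w * (3 / 4) <= w * A by rewrite ler_wpM2l.
by lra.
Qed.

(** The one-step bounds are hypotheses because this is used inside the induction that proves them.
    Of the total 4 w, each one-step difference costs w, and 1 - (g 1)^2 = w (2 - w) costs at most 2
    w. *)
Let two_step j : (j.+2 <= M)%N ->
  `|m j.+1 - g 1 * m j| <= w * rho ^+ j.+1 ->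
  `|m j.+2 - g 1 * m j.+1| <= w * rho ^+ j.+2 ->
  `|m j.+2 - m j| <= 4 * w * rho ^+ j.
Proof.
move=> jM h1 h2.
have -> : m j.+2 - m j = (m j.+2 - g 1 * m j.+1) +
   g 1 * (m j.+1 - g 1 * m j) + (g 1 ^+ 2 - 1) * m j by ring.
apply: le_trans (ler_normD _ _) _.
apply: le_trans (lerD (ler_normD _ _) (lexx _)) _.
have r0 := exprn_ge0 j rho_ge0.
have r1 : rho ^+ j.+1 <= rho ^+ j by rewrite exprS ler_piMl.
have r2 : rho ^+ j.+2 <= rho ^+ j.
  by apply: le_trans r1; rewrite exprS ler_piMl // exprn_ge0.
have hm := multiplier_decay (ltnW (ltnW jM)).
have -> : 4 * w * rho ^+ j = w * rho ^+ j + 1 * (w * rho ^+ j) + (2 * w) * rho ^+ j.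
  by ring.
apply: lerD; first apply: lerD.
- by apply: le_trans h2 _; rewrite ler_wpM2l.
- rewrite normrM; apply: ler_pM => //.
  by apply: le_trans h1 _; rewrite ler_wpM2l.
- rewrite normrM; apply: ler_pM => //.
  rewrite -real_normK ?num_real // g1 ler_norml.
  have : 0 <= w * (1 - w) by rewrite mulr_ge0 ?subr_ge0.
  move: (sqr_ge0 w) w_ge0.
  by move=> *; apply/andP; split; lra.
Qed.

Let many_steps n : (n <= M)%N ->
  (forall j, (j < n)%N -> `|m j.+1 - g 1 * m j| <= w * rho ^+ j.+1) ->
  forall t j, (j + t.*2 <= n)%N ->
    `|m (j + t.*2) - m j| <= 4 * w * t%:R * rho ^+ j.
Proof.
move=> nM IH; elim=> [|t IHt] j jt.
  by rewrite addn0 subrr normr0 mulr0 mul0r.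
rewrite doubleS !addnS in jt *.
have -> : m (j + t.*2).+2 - m j =
   (m (j + t.*2).+2 - m (j + t.*2)) + (m (j + t.*2) - m j) by ring.
apply: le_trans (ler_normD _ _) _.
rewrite -[t.+1%:R]natr1 mulrDr mulr1 mulrDl addrC.
apply: lerD; first by apply: IHt; exact: ltnW (ltnW jt).
apply: (@le_trans _ _ (4 * w * rho ^+ (j + t.*2))).
  apply: two_step; first exact: leq_trans nM.
    by apply: IH; exact: ltnW.
  by apply: IH.
rewrite ler_wpM2l ?mulr_ge0 //.
by rewrite exprD ler_piMr ?exprn_ge0 // exprn_ile1.
Qed.

(** As the odd weights sum to 1, [g 1 * m n] can be distributed over the odd lags of the recurrence.
    The term k = 1 then cancels. For odd k >= 3 the lag k - 1 is even, so [many_steps] applies to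
    indices already treated; for even k, [g k] is close to 1. Each remaining term is at most 2 k^2 w
    rho^(n + 1 - k). *)
Lemma multiplier_step n : (n < M)%N ->
  `|m n.+1 - g 1 * m n| <= w * rho ^+ n.+1.
Proof.
elim/ltn_ind: n => n IH nM.
have nM' : (0 < n.+1 <= M)%N by [].
have steps := many_steps (ltnW nM) (fun j jn => IH j jn (ltn_trans jn nM)).
have -> : m n.+1 - g 1 * m n = \sum_(1 <= k < n.+2)
   W n.+1 k * ((g k - (~~ odd k)%:R) * m (n.+1 - k) - (odd k)%:R * (g 1 * m n)).
  under eq_bigr do rewrite mulrBr [_ * (_%:R * _)]mulrA mulrA.
  by rewrite sumrB -m_rec // -big_distrl /= W_odd // mul1r.
apply: le_trans (ler_norm_sum _ _ _) _.
rewrite big_ltn // subSS subn0 /= subr0 mul1r subrr mulr0 normr0 add0r.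
have r0 := exprn_ge0 n.+1 rho_ge0.
apply: (@le_trans _ _ (\sum_(2 <= k < n.+2) W n.+1 k * 8 ^+ k * (2 * (w * rho ^+ n.+1)))); last first.
  rewrite -big_distrl /= mulrA ler_piMl ?mulr_ge0 //.
  by have := W_sum8 nM'; lra.
rewrite !big_nat; apply: ler_sum => k /andP[k2 kn].
rewrite normrM (ger0_norm (W_ge0 _ _)) -!mulrA ler_wpM2l //.
have rk0 := exprn_ge0 (n.+1 - k) rho_ge0.
have hm : `|m (n.+1 - k)| <= rho ^+ (n.+1 - k).
  by rewrite multiplier_decay // (leq_trans (leq_subr _ _)).
suff : `|(g k - (~~ odd k)%:R) * m (n.+1 - k) - (odd k)%:R * (g 1 * m n)|
      <= 2 * (k%:R ^+ 2 * w * rho ^+ (n.+1 - k)).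
  by have := @sqr_shift n.+1 k kn; lra.
have [ko|ke] := boolP (odd k) => /=.
  have kE : k = (k./2.*2).+1 by rewrite -[LHS]odd_double_half ko.
  rewrite subr0 mul1r.
  have -> : g k * m (n.+1 - k) - g 1 * m n =
     (g k - g 1) * m (n.+1 - k) - g 1 * (m n - m (n.+1 - k)) by ring.
  apply: le_trans (ler_normB _ _) _; rewrite !normrM.
  have h1 : `|g k - g 1| * `|m (n.+1 - k)| <= k%:R ^+ 2 * w * rho ^+ (n.+1 - k).
    by apply: ler_pM => //; apply: g_odd.
  have nE : n = (n.+1 - k + k./2.*2)%N by move: kE kn; clear; lia.
  have h2 : `|m n - m (n.+1 - k)| <= 4 * w * (k./2)%:R * rho ^+ (n.+1 - k).
    by rewrite {1}nE; apply: steps; rewrite -nE.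
  have h3 : 4 * (k./2)%:R <= k%:R ^+ 2 :> R.
    by rewrite -natrX -natrM ler_nat; move: kE; clear; nia.
  have h4 : `|g 1| * `|m n - m (n.+1 - k)| <= 1 * `|m n - m (n.+1 - k)|.
    by rewrite ler_wpM2r // g_le1.
  have h5 : 4 * w * (k./2)%:R * rho ^+ (n.+1 - k) <= k%:R ^+ 2 * w * rho ^+ (n.+1 - k).
    by rewrite ler_wpM2r // mulrAC ler_wpM2r.
  by move: h1 h2 h4 h5; lra.
rewrite mul0r subr0 normrM mulr2n mulrDl mul1r.
apply: ler_wpDr; first by rewrite !mulr_ge0 // sqr_ge0.
by apply: ler_pM => //; apply: g_even.
Qed.

Lemma multiplier_step2 n : (n.+2 <= M)%N -> `|m n.+2 - m n| <= 4 * w * rho ^+ n.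
Proof. by move=> nM; apply: two_step => //; apply: multiplier_step; rewrite // ltnW. Qed.

Lemma multiplier_pow n : (n <= M)%N -> `|m n - g 1 ^+ n| <= n%:R * w * rho ^+ n.
Proof.
elim: n => [|n IH] nM; first by rewrite m0 expr0 subrr normr0 !mul0r.
have -> : m n.+1 - g 1 ^+ n.+1 = (m n.+1 - g 1 * m n) + g 1 * (m n - g 1 ^+ n).
  by rewrite exprS; ring.
apply: le_trans (ler_normD _ _) _; rewrite normrM g1.
rewrite -natr1 !mulrDl mul1r [X in _ <= X]addrC.
apply: lerD; first exact: multiplier_step.
rewrite -mulrDl exprS [X in _ <= X]mulrCA; apply: ler_pM; rewrite ?subr_ge0 //.
  by move: w_ge0; rewrite /rho; lra.
by apply: IH; exact: ltnW.
Qed.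

Let sum_geom_deriv (r : R) n : 0 <= r <= 1 ->
  (1 - r) ^+ 2 * \sum_(0 <= i < n) i.+1%:R * r ^+ i <= 1.
Proof.
move=> /andP[r0 r1].
have -> : (1 - r) ^+ 2 * \sum_(0 <= i < n) i.+1%:R * r ^+ i =
    1 - n.+1%:R * r ^+ n + n%:R * r ^+ n.+1.
  elim: n => [|n IH]; first by rewrite big_geq // expr0 mul0r addr0 mulr0 mulr1 subrr.
  by rewrite big_nat_recr //= mulrDr IH -[n.+2%:R]natr1 -!natr1 !exprS; ring.
rewrite exprS -natr1; have := exprn_ge0 n r0; have : 0 <= n%:R :> R by [].
set x := n%:R; set y := r ^+ n => hx hy.
have : 0 <= x * y * (1 - r) by rewrite !mulr_ge0 ?subr_ge0.
by move: hx hy; lra.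
Qed.

(** The bound is uniform in w: the factor w^2 compensates the sum of the series, which is at most 1
    / (1 - rho)^2 = 4 / w^2. This makes both square functions bounded at all frequencies alike. *)
Let sum_w n : w ^+ 2 * \sum_(0 <= i < n) i.+1%:R * rho ^+ i <= 4.
Proof.
have := @sum_geom_deriv rho n; rewrite rho_ge0 rho_le1 => /(_ isT).
have -> : (1 - rho) ^+ 2 = w ^+ 2 / 4 by rewrite /rho; field.
by rewrite -mulrA [4^-1 * _]mulrC mulrA; lra.
Qed.

Lemma sum_sqr_multiplier_pow n : (n <= M)%N ->
  \sum_(1 <= i < n.+1) (m i - g 1 ^+ i) ^+ 2 / i%:R <= 4.
Proof.
move=> nM; rewrite big_add1 /=; apply: le_trans (sum_w n); rewrite mulr_sumr.
rewrite !big_nat; apply: ler_sum => i /= iM.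
rewrite ler_pdivrMr ?ltr0n //.
have h : `|m i.+1 - g 1 ^+ i.+1| <= i.+1%:R * w * rho ^+ i.+1.
  by apply: multiplier_pow; exact: leq_trans nM.
rewrite -real_normK ?num_real //.
have q : 0 <= i.+1%:R * w * rho ^+ i.+1 by rewrite !mulr_ge0 ?exprn_ge0.
apply: (@le_trans _ _ ((i.+1%:R * w * rho ^+ i.+1) ^+ 2)).
  by rewrite ler_pXn2r // nnegrE.
have -> : w ^+ 2 * (i.+1%:R * rho ^+ i) * i.+1%:R =
  (i.+1%:R ^+ 2 * w ^+ 2) * rho ^+ i by ring.
rewrite !exprMn ler_wpM2l ?mulr_ge0 ?sqr_ge0 //.
by rewrite -exprM ler_wiXn2l //; clear; lia.
Qed.

Lemma sum_sqr_multiplier_step2 n : (n <= M)%N ->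
  \sum_(2 <= j < n.+1) j%:R * (m j - m (j - 2)) ^+ 2 <= 128.
Proof.
case: n => [|n] nM; first by rewrite big_geq.
rewrite big_add1 big_add1 /=.
have : 32 * (w ^+ 2 * \sum_(0 <= i < n) i.+1%:R * rho ^+ i) <= 128.
  by have := sum_w n; lra.
apply: le_trans; rewrite !mulr_sumr.
rewrite !big_nat; apply: ler_sum => i /= iM; rewrite subSS subn1 /=.
have h : `|m i.+2 - m i| <= 4 * w * rho ^+ i.
  by apply: multiplier_step2; exact: leq_trans nM.
rewrite -(real_normK (num_real (m i.+2 - m i))).
have q : 0 <= 4 * w * rho ^+ i by rewrite !mulr_ge0 ?exprn_ge0.
have h2 : `|m i.+2 - m i| ^+ 2 <= 16 * w ^+ 2 * rho ^+ i.
  apply: (@le_trans _ _ ((4 * w * rho ^+ i) ^+ 2)).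
    by rewrite ler_pXn2r // nnegrE.
  rewrite !exprMn.
  have -> : 4 ^+ 2 * w ^+ 2 = 16 * w ^+ 2 :> R by ring.
  rewrite ler_wpM2l ?mulr_ge0 ?sqr_ge0 //.
  by rewrite -exprM ler_wiXn2l //; clear; lia.
have h3 : i.+2%:R <= 2 * i.+1%:R :> R by rewrite -natrM ler_nat; clear; lia.
have -> : 32 * (w ^+ 2 * (i.+1%:R * rho ^+ i)) = (2 * i.+1%:R) * (16 * w ^+ 2 * rho ^+ i).
  by ring.
by apply: ler_pM => //; exact: sqr_ge0.
Qed.

End MultiplierDecay.

(** * The generating function of the spheres *)

Section GeneratingFunction.
Context {R : realType}.
Implicit Types (x th : R).

Lemma norm_sin_natl_le x k : `|sin (k%:R * x)| <= k%:R * `|sin x|.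
Proof.
elim: k => [|k IH]; first by rewrite !mul0r sin0 normr0.
rewrite -natr1 !mulrDl !mul1r sinD; apply: le_trans (ler_normD _ _) _.
rewrite !normrM; apply: lerD.
  by apply: le_trans IH; rewrite ler_piMr // cos_max.
by rewrite ler_piMl // cos_max.
Qed.

Lemma onem_cos_natl_le th k : 1 - cos (k%:R * th) <= k%:R ^+ 2 * (1 - cos th).
Proof.
have E x : 1 - cos (x *+ 2) = 2 * `|sin x| ^+ 2.
  by rewrite cos_mulr2n real_normK ?num_real // sin2cos2; ring.
have -> : th = (th / 2) *+ 2 by rewrite mulr2n -mulrDr; lra.
rewrite mulrnAr !E [X in _ <= X]mulrCA ler_wpM2l // -exprMn.
by rewrite ler_pXn2r ?nnegrE ?mulr_ge0 // norm_sin_natl_le.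
Qed.

Lemma cos_natlDpi th k : cos (k%:R * (th + pi)) = (-1) ^+ k * cos (k%:R * th).
Proof.
by rewrite mulrDr mulr_natl mulr_natl alternatingn //; exact: cosDpi.
Qed.

(** The left sum runs over the frequencies r, r - 2, ..., -r, and folding it doubles the nonnegative
    ones. For even r the frequency 0 occurs once on the left but is doubled on the right, whence the
    correction. *)
Lemma dirichlet_sum th r :
  \sum_(k < r.+1) cos ((r%:R - 2 * k%:R) * th) + (~~ odd r)%:R =
  2 * \sum_(k < r.+1) (~~ odd k)%:R * cos ((r - k)%:R * th).
Proof.
elim/ltn_ind: r => -[_|[_|r IH]].
- by rewrite !big_ord1 /= mulr0 subr0 !mul0r cos0; lra.
- rewrite !big_ord_recl !big_ord0 /= subn0 mulr0 subr0 mulr1 !mul1r.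
  by rewrite (_ : (1 - 2) * th = - th) ?cosN ?mul0r; [ring|ring].
rewrite big_ord_recr big_ord_recl /=.
under eq_bigr => k _.
  rewrite /bump /= add1n.
  have -> : r.+2%:R - 2 * k.+1%:R = r%:R - 2 * k%:R :> R.
    by rewrite -!natr1; ring.
  over.
have -> : (r.+2%:R - 2 * 0%:R) * th = r.+2%:R * th :> R by ring.
have -> : (r.+2%:R - 2 * r.+2%:R) * th = - (r.+2%:R * th) :> R by ring.
have -> : \sum_(k < r.+3) (~~ odd k)%:R * cos ((r.+2 - k)%:R * th) =
    cos (r.+2%:R * th) + \sum_(k < r.+1) (~~ odd k)%:R * cos ((r - k)%:R * th).
  rewrite 2!big_ord_recl /= subn0 mul1r mul0r add0r; congr (_ + _).
  by apply: eq_bigr => k _; rewrite /= /bump /= !add1n /= negbK.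
have := IH r (ltnW (ltnSn _)).
by rewrite cosN negbK mulrDr => <-; ring.
Qed.

(* The one-dimensional spheres {-r, r}, and the coefficients of q times the
   logarithmic derivative of their generating function
   (1 - q^2) / (1 - 2 q cos th + q^2). *)
Definition sphere1 th (r : nat) : R := if r is 0 then 1 else 2 * cos (r%:R * th).

Definition logder th (k : nat) : R := 2 * cos (k%:R * th) - 2 * (~~ odd k)%:R.

Lemma sphere1_logder th r :
  r%:R * sphere1 th r = \sum_(k < r.+1) logder th k * sphere1 th (r - k).
Proof.
case: r => [|r]; first by rewrite big_ord1 mul0r /logder mul0r cos0 /=; lra.
(* [sphere1 th 0] is 1 whereas 2 cos 0 is 2; replacing it in the term k = r + 1 costs one
   [logder th r.+1]. *)
have -> : \sum_(k < r.+2) logder th k * sphere1 th (r.+1 - k) =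
  \sum_(k < r.+2) logder th k * (2 * cos ((r.+1 - k)%:R * th)) - logder th r.+1.
  rewrite [in LHS]big_ord_recr [in RHS]big_ord_recr /= subnn mul0r cos0 /=.
  rewrite -[LHS]/(_ + logder th r.+1 * 1) mulr1.
  under eq_bigr => k _ do rewrite subSn -1?ltnS ?ltn_ord //= -subSn -1?ltnS //.
  by ring.
have -> : \sum_(k < r.+2) logder th k * (2 * cos ((r.+1 - k)%:R * th)) =
  \sum_(k < r.+2) (2 * cos (r.+1%:R * th) + 2 * cos ((r.+1%:R - 2 * k%:R) * th)
    - 4 * ((~~ odd k)%:R * cos ((r.+1 - k)%:R * th))).
  apply: eq_bigr => k _; rewrite natrB -1?ltnS // /logder.
  have -> : r.+1%:R * th = k%:R * th + (r.+1%:R - k%:R) * th by ring.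
  have -> : (r.+1%:R - 2 * k%:R) * th = (r.+1%:R - k%:R) * th - k%:R * th by ring.
  by rewrite cosD cosB; ring.
rewrite sumrB big_split /= sumr_const card_ord -!mulr_sumr.
have := dirichlet_sum th r.+1 => /= D.
have -> : 4 * \sum_(i < r.+2) (~~ odd i)%:R * cos ((r.+1 - i)%:R * th) =
  2 * (\sum_(k < r.+2) cos ((r.+1%:R - 2 * k%:R) * th) + (~~ ~~ odd r)%:R).
  by rewrite D; ring.
rewrite /logder /= -[_ *+ r.+2]mulr_natl -[r.+2%:R]natr1 -[r.+1%:R]natr1.
by ring.
Qed.

Variable M : nat.

Definition sphere1_gf th : {poly R} := \poly_(r < M.+1) sphere1 th r.

Definition logder_gf th : {poly R} := \poly_(k < M.+1) logder th k.

Let dvdXn (p : {poly R}) : (forall n, (n <= M)%N -> p`_n = 0) -> 'X^(M.+1) %| p.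
Proof.
move=> p0; have -> : p = drop_poly M.+1 p * 'X^(M.+1).
  rewrite -[LHS](poly_take_drop M.+1) (_ : take_poly _ _ = 0) ?add0r //.
  by apply/polyP => n; rewrite coef_take_poly coef0; case: ifP => // /p0.
exact: dvdp_mulIr.
Qed.

Let dvdXn_coef (p : {poly R}) n : (n <= M)%N -> 'X^(M.+1) %| p -> p`_n = 0.
Proof. by move=> nM /dvdpP[q ->]; rewrite coefMXn ltnS nM. Qed.

(** P is X A' / A modulo X^(M + 1), written without division. In this form the product over the
    coordinates becomes a sum of logarithmic derivatives, and comparing coefficients gives the
    recurrence in every dimension. *)
Let is_logder (A P : {poly R}) := 'X^(M.+1) %| 'X * A^`() - A * P.

Let is_logder1 th : is_logder (sphere1_gf th) (logder_gf th).
Proof.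
apply: dvdXn => n nM; rewrite coefB coefXM coef_deriv.
have -> : (if n == 0%N then 0 else (sphere1_gf th)`_n.-1.+1 *+ n.-1.+1) =
    n%:R * sphere1 th n.
  by case: n nM => [|n] nM; rewrite ?mul0r //= coef_poly ltnS nM mulr_natl.
rewrite sphere1_logder mulrC coefM; apply/eqP; rewrite subr_eq0; apply/eqP.
apply: eq_bigr => k _; have kn : (k <= n)%N by rewrite -ltnS.
rewrite !coef_poly !ltnS (leq_trans kn nM).
by rewrite (leq_trans (leq_subr _ _) nM).
Qed.

Let is_logderM A P B Q :
  is_logder A P -> is_logder B Q -> is_logder (A * B) (P + Q).
Proof.
rewrite /is_logder => hA hB; rewrite derivM.
have -> : 'X * (A^`() * B + A * B^`()) - A * B * (P + Q) =
  ('X * A^`() - A * P) * B + ('X * B^`() - B * Q) * A by ring.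
by apply: dvdp_add; apply: dvdp_mulr.
Qed.

Context {d : nat}.

Definition sphere_gf (th : 'I_d -> R) : {poly R} := \prod_i sphere1_gf (th i).

Lemma sphere_gf_rec (th : 'I_d -> R) n : (n <= M)%N ->
  n%:R * (sphere_gf th)`_n =
  \sum_(k < n.+1) (\sum_i logder (th i) k) * (sphere_gf th)`_(n - k).
Proof.
move=> nM.
have : is_logder (sphere_gf th) (\sum_i logder_gf (th i)).
  apply: (@big_rec2 _ _ is_logder) => [|i A P _ h].
    by rewrite /is_logder derivC mulr0 mulr0 subr0 dvdp0.
  by apply: is_logderM.
move/(dvdXn_coef nM)/eqP; rewrite coefB subr_eq0 coefXM coef_deriv => /eqP.
have -> : (if n == 0%N then 0 else (sphere_gf th)`_n.-1.+1 *+ n.-1.+1) =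
    n%:R * (sphere_gf th)`_n.
  by case: n nM => [|n] nM; rewrite ?mul0r //= mulr_natl.
move=> ->; rewrite mulrC coefM; apply: eq_bigr => k _; rewrite coef_sum.
congr (_ * _); apply: eq_bigr => i _.
by rewrite coef_poly ltnS (leq_trans _ nM) // -ltnS.
Qed.

Lemma sphere_gf0 (th : 'I_d -> R) : (sphere_gf th)`_0 = 1.
Proof.
rewrite /sphere_gf; elim/big_rec: _ => [|i p _ h]; first by rewrite coefC.
by rewrite coefM big_ord1 subn0 h mulr1 coef_poly.
Qed.

(** At frequency 0 the coefficient is the number of lattice points of the sphere of radius n, for n
    <= M. *)
Definition sphere_count n : R := (sphere_gf (fun=> 0))`_n.

Definition multiplier (th : 'I_d -> R) n := (sphere_gf th)`_n / sphere_count n.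

Definition mean_cos (th : 'I_d -> R) (k : nat) :=
  (\sum_i cos (k%:R * th i)) / d%:R.

Hypotheses (d_gt0 : (0 < d)%N) (M_le : (500 * M <= d)%N).

Let d0 : 0 < d%:R :> R. Proof. by rewrite ltr0n. Qed.

Let sphere_count_rec n : (n <= M)%N ->
  n%:R * sphere_count n =
  \sum_(1 <= k < n.+1) 2 * d%:R * (odd k)%:R * sphere_count (n - k).
Proof.
move=> nM; rewrite sphere_gf_rec // -(big_mkord predT (fun k =>
  (\sum_(i < d) logder 0 k) * sphere_count (n - k))) big_ltn //=.
rewrite /logder sumr_const mul0r cos0 /= subrr mul0rn mul0r add0r.
apply: eq_bigr => k _; rewrite sumr_const card_ord mulr0 cos0 mulr1.
by case: (odd k) => /=; rewrite -mulr_natl; ring.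
Qed.

Lemma sphere_count_gt0 n : (n <= M)%N -> 0 < sphere_count n.
Proof.
elim/ltn_ind: n => -[_ _|n IH nM]; first by rewrite /sphere_count sphere_gf0.
rewrite -(@pmulr_rgt0 _ n.+1%:R) // sphere_count_rec // big_ltn // subSS subn0.
apply: ltr_wpDr; last by rewrite !mulr_gt0 // IH // ltnW.
rewrite big_nat; apply: sumr_ge0 => k /andP[k2 kn]; rewrite !mulr_ge0 //.
by rewrite ltW // IH ?(leq_trans (leq_subr _ _)) // ltn_subrL (ltnW k2).
Qed.

(** With s for [sphere_count], keeping only the term k = 1 of the recurrence gives 2 d s(n - 1) <= n
    s(n); this is iterated k times. *)
Let sphere_count_shift n k : (k <= n <= M)%N ->
  sphere_count (n - k) <= (n%:R / (2 * d%:R)) ^+ k * sphere_count n.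
Proof.
move=> /andP[]; elim: k => [|k IH] kn nM; first by rewrite subn0 expr0 mul1r.
apply: (@le_trans _ _ (n%:R / (2 * d%:R) * sphere_count (n - k))); last first.
  rewrite exprS -[X in _ <= X]mulrA ler_wpM2l ?IH //; first exact: ltnW.
have nkM : (n - k <= M)%N by rewrite (leq_trans (leq_subr _ _)).
rewrite mulrAC ler_pdivlMr ?mulr_gt0 // mulrC.
apply: (@le_trans _ _ ((n - k)%:R * sphere_count (n - k))); last first.
  by rewrite ler_wpM2r ?ler_nat ?leq_subr // ltW // sphere_count_gt0.
rewrite sphere_count_rec // big_ltn ?ltnS ?subn_gt0 //= mulr1.
rewrite -subnDA addn1 lerDl big_nat; apply: sumr_ge0 => j _.
rewrite !mulr_ge0 // ltW // sphere_count_gt0 //.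
by rewrite (leq_trans (leq_subr _ _)).
Qed.

(** The value 0 for n > M gives nonnegativity for all n and k, the form in which the decay section
    asks for it. *)
Let weight n k : R :=
  if (n <= M)%N then 2 * d%:R * sphere_count (n - k) / (n%:R * sphere_count n) else 0.

Let weight_ge0 n k : 0 <= weight n k.
Proof.
rewrite /weight; case: ifP => // nM; rewrite divr_ge0 ?mulr_ge0 //.
  by rewrite ltW // sphere_count_gt0 // (leq_trans (leq_subr _ _)).
by rewrite ltW // sphere_count_gt0.
Qed.

Let weight_odd n : (0 < n <= M)%N ->
  \sum_(1 <= k < n.+1) weight n k * (odd k)%:R = 1.
Proof.
move=> /andP[n0 nM]; have c0 := sphere_count_gt0 nM.
rewrite /weight nM; under eq_bigr do rewrite mulrAC [_ * (odd _)%:R]mulrAC.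
by rewrite -big_distrl /= -sphere_count_rec // divff // mulf_neq0 ?gt_eqF ?ltr0n.
Qed.

(** The weight is at most (n / (2 d))^(k - 1), and [500 * M <= d] makes the ratio at most 1 /
    1000. *)
Let weight_le n k : (0 < k)%N -> (k <= n <= M)%N ->
  weight n k <= (1000^-1) ^+ k.-1.
Proof.
case: k => // k _ /andP[kn nM]; rewrite /weight nM /=.
have c0 := sphere_count_gt0 nM; have n0 : 0 < n%:R :> R by rewrite ltr0n (leq_ltn_trans _ kn).
rewrite ler_pdivrMr ?mulr_gt0 //.
have q0 : 0 < 2 * d%:R :> R by rewrite mulr_gt0.
apply: (@le_trans _ _ (2 * d%:R * ((n%:R / (2 * d%:R)) ^+ k.+1 * sphere_count n))).
  by rewrite ler_wpM2l ?(ltW q0) // sphere_count_shift // kn.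
rewrite exprS; set x := _ ^+ k.
have -> : 2 * d%:R * (n%:R / (2 * d%:R) * x * sphere_count n) = n%:R * x * sphere_count n.
  by field; rewrite gt_eqF.
rewrite mulrA [_ * n%:R]mulrC ler_wpM2r ?(ltW c0) // ler_wpM2l ?(ltW n0) // lerXn2r //.
- by rewrite nnegrE divr_ge0 // ltW.
- by rewrite nnegrE invr_ge0 ler0n.
have : 500%:R * n%:R <= d%:R :> R.
  by rewrite -natrM ler_nat (leq_trans _ M_le) // leq_mul2l nM orbT.
by rewrite ler_pdivrMr //; lra.
Qed.

Lemma multiplier0 (th : 'I_d -> R) : multiplier th 0 = 1.
Proof. by rewrite /multiplier /sphere_count !sphere_gf0 divr1. Qed.

Let multiplier_rec (th : 'I_d -> R) n : (0 < n <= M)%N -> multiplier th n =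
  \sum_(1 <= k < n.+1)
    weight n k * (mean_cos th k - (~~ odd k)%:R) * multiplier th (n - k).
Proof.
move=> /andP[n0 nM]; have n0' : n%:R != 0 :> R by rewrite pnatr_eq0 -lt0n.
have c0 := sphere_count_gt0 nM.
rewrite /multiplier -[LHS](mulKf n0') [n%:R * _]mulrA sphere_gf_rec //.
rewrite -(big_mkord predT (fun k =>
  (\sum_i logder (th i) k) * (sphere_gf th)`_(n - k))) big_ltn //=.
rewrite [\sum_(i < d) _]big1 => [|i _]; last by rewrite /logder mul0r cos0 /=; lra.
rewrite mul0r add0r mulr_suml mulr_sumr !big_nat; apply: eq_bigr => k /andP[k0 kn].
have c1 : sphere_count (n - k) != 0.
  by rewrite gt_eqF // sphere_count_gt0 // (leq_trans (leq_subr _ _)).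
have -> : \sum_(i < d) logder (th i) k = 2 * d%:R * (mean_cos th k - (~~ odd k)%:R).
  rewrite /logder sumrB -mulr_sumr sumr_const card_ord /mean_cos -mulr_natl.
  by field; rewrite gt_eqF.
by rewrite /weight nM; field; rewrite ?c1 ?n0' gt_eqF.
Qed.

Lemma multiplier1 (th : 'I_d -> R) : (0 < M)%N -> multiplier th 1 = mean_cos th 1.
Proof.
move=> M0; rewrite multiplier_rec // big_nat1 subnn multiplier0 mulr1 subr0.
by have := @weight_odd 1 M0; rewrite big_nat1 mulr1 => ->; rewrite mul1r.
Qed.

Let mean_cosD (th : 'I_d -> R) k a b :
  mean_cos th k * a + b = (\sum_i (cos (k%:R * th i) * a + b)) / d%:R.
Proof.
rewrite big_split /= -mulr_suml sumr_const card_ord -[b *+ d]mulr_natl /mean_cos.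
by field; rewrite gt_eqF.
Qed.

Let mean_cos_mono (th : 'I_d -> R) k a b k' a' b' :
  (forall x, cos (k%:R * x) * a + b <= cos (k'%:R * x) * a' + b') ->
  mean_cos th k * a + b <= mean_cos th k' * a' + b'.
Proof.
by move=> h; rewrite !mean_cosD ler_pM2r ?invr_gt0 //; apply: ler_sum => i _.
Qed.

Let mean_cos_le1 (th : 'I_d -> R) k : `|mean_cos th k| <= 1.
Proof.
rewrite normrM [X in _ * X]ger0_norm ?invr_ge0 // ler_pdivrMr // mul1r.
apply: le_trans (ler_norm_sum _ _ _) _.
by rewrite -[X in _ <= X%:R]card_ord -sumr_const; apply: ler_sum => i _; exact: cos_max.
Qed.

Let onem_mean_cos_le (th : 'I_d -> R) k :
  1 - mean_cos th k <= k%:R ^+ 2 * (1 - mean_cos th 1).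
Proof.
suff : mean_cos th k * (-1) + 1 <= mean_cos th 1 * (- k%:R ^+ 2) + k%:R ^+ 2 by lra.
by apply: mean_cos_mono => x; have := onem_cos_natl_le x k; rewrite mul1r; lra.
Qed.

(* The symmetry theta -> theta + pi. *)
Let onep_mean_cos_le (th : 'I_d -> R) k :
  1 - (-1) ^+ k * mean_cos th k <= k%:R ^+ 2 * (1 + mean_cos th 1).
Proof.
suff : mean_cos th k * (- (-1) ^+ k) + 1 <= mean_cos th 1 * k%:R ^+ 2 + k%:R ^+ 2.
  by lra.
apply: mean_cos_mono => x; have := onem_cos_natl_le (x + pi) k.
by rewrite cos_natlDpi cosDpi mul1r; lra.
Qed.

(** For even k the bound holds both with 1 - lambda and, by the symmetry, with 1 + lambda, where
    lambda is [mean_cos th 1]; one of the two is 1 - |lambda|. *)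
Let mean_cos_even (th : 'I_d -> R) k : ~~ odd k ->
  `|mean_cos th k - 1| <= k%:R ^+ 2 * (1 - `|mean_cos th 1|).
Proof.
move=> ke; have := onep_mean_cos_le th k; rewrite -signr_odd (negPf ke) mul1r.
have := onem_mean_cos_le th k; have := ler_normlW (mean_cos_le1 th k).
rewrite -normrN opprB => h1 h2 h3; rewrite ger0_norm ?subr_ge0 //.
by have [_|_] := ler0P (mean_cos th 1); rewrite ?opprK.
Qed.

(** Both means lie in [-1, 1] and within k^2 (1 - |lambda|) of the same endpoint, the one given by
    the sign of lambda = [mean_cos th 1], hence within that distance of each other. *)
Let mean_cos_odd (th : 'I_d -> R) k : odd k ->
  `|mean_cos th k - mean_cos th 1| <= k%:R ^+ 2 * (1 - `|mean_cos th 1|).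
Proof.
move=> ko; have := onep_mean_cos_le th k.
rewrite -signr_odd ko expr1 mulN1r opprK.
have := onem_mean_cos_le th k.
have := mean_cos_le1 th 1; rewrite ler_norml => /andP[].
have := mean_cos_le1 th k; rewrite ler_norml => /andP[].
have k1 : 1 <= k%:R ^+ 2 :> R by rewrite exprn_ege1 // ler1n; case: (k) ko.
set g := mean_cos th k; set l := mean_cos th 1 => g1 g2 l1 l2 h1 h2.
have h3 : 1 * (1 - l) <= k%:R ^+ 2 * (1 - l) by rewrite ler_wpM2r // subr_ge0.
have h4 : 1 * (1 + l) <= k%:R ^+ 2 * (1 + l) by rewrite ler_wpM2r //; lra.
by rewrite ler_norml; have [_|_] := ler0P l; apply/andP; split; lra.
Qed.

Let mean_cos1_onem (th : 'I_d -> R) :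
  `|mean_cos th 1| = 1 - (1 - `|mean_cos th 1|).
Proof. by rewrite opprB addrC subrK. Qed.

Lemma sum_sqr_sphere_multiplier_pow (th : 'I_d -> R) : (0 < M)%N ->
  \sum_(1 <= i < M.+1) (multiplier th i - multiplier th 1 ^+ i) ^+ 2 / i%:R <= 4.
Proof.
move=> M0; rewrite multiplier1 //.
apply: (@sum_sqr_multiplier_pow _ weight _ _ M (1 - `|mean_cos th 1|)) => //.
- by rewrite subr_ge0.
- exact: multiplier0.
- exact: multiplier_rec.
- by move=> k; exact: mean_cos_even.
- by move=> k; exact: mean_cos_odd.
Qed.

Lemma sum_sqr_sphere_multiplier_step2 (th : 'I_d -> R) :
  \sum_(2 <= j < M.+1)
    j%:R * (multiplier th j - multiplier th (j - 2)) ^+ 2 <= 128.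
Proof.
apply: (@sum_sqr_multiplier_step2 _ weight (mean_cos th) _ M
  (1 - `|mean_cos th 1|)) => //.
- by rewrite subr_ge0.
- exact: multiplier0.
- exact: multiplier_rec.
- by move=> k; exact: mean_cos_even.
- by move=> k; exact: mean_cos_odd.
Qed.

End GeneratingFunction.

(** * The maximal ergodic inequality for symmetric Markov kernels *)

Lemma cauchy_schwarz_sum (R : realFieldType) (I : Type) (r : seq I) (a b : I -> R) :
  (\sum_(i <- r) a i * b i) ^+ 2 <=
  (\sum_(i <- r) a i ^+ 2) * (\sum_(i <- r) b i ^+ 2).
Proof.
(* Lagrange's identity: this double sum is twice the defect in the Cauchy-Schwarz inequality. *)
have : 0 <= \sum_(i <- r) \sum_(j <- r) (a i * b j - a j * b i) ^+ 2.
  by apply: sumr_ge0 => i _; apply: sumr_ge0 => j _; exact: sqr_ge0.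
have -> : \sum_(i <- r) \sum_(j <- r) (a i * b j - a j * b i) ^+ 2 =
  2 * ((\sum_(i <- r) a i ^+ 2) * (\sum_(i <- r) b i ^+ 2)) -
  2 * (\sum_(i <- r) a i * b i) ^+ 2.
  have -> : 2 * ((\sum_(i <- r) a i ^+ 2) * (\sum_(i <- r) b i ^+ 2)) =
     (\sum_(i <- r) a i ^+ 2) * (\sum_(j <- r) b j ^+ 2) +
     (\sum_(i <- r) b i ^+ 2) * (\sum_(j <- r) a j ^+ 2) by ring.
  have -> : 2 * (\sum_(i <- r) a i * b i) ^+ 2 =
      (\sum_(i <- r) 2 * (a i * b i)) * (\sum_(j <- r) a j * b j).
    by rewrite -mulr_sumr; ring.
  rewrite !mulr_suml -big_split -sumrB /=; apply: eq_bigr => i _.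
  rewrite !mulr_sumr -big_split -sumrB /=; apply: eq_bigr => j _; ring.
by rewrite subr_ge0 ler_pM2l.
Qed.

Section MaximalErgodic.
Context {R : realFieldType} {X : finType}.
Implicit Types (k l : X -> X -> R) (f g : X -> R) (nu : X -> nat).

Definition kmul k l x y := \sum_z k x z * l z y.

Lemma kmulA k l (j : X -> X -> R) x y :
  kmul k (kmul l j) x y = kmul (kmul k l) j x y.
Proof.
rewrite /kmul; under eq_bigr do rewrite mulr_sumr.
rewrite exchange_big; apply: eq_bigr => z _; rewrite mulr_suml.
by apply: eq_bigr => i _; rewrite mulrA.
Qed.

Variable t : X -> X -> R.
Hypothesis t_ge0 : forall x y, 0 <= t x y.
Hypothesis t_sym : forall x y, t x y = t y x.
Hypothesis t_row : forall x, \sum_y t x y = 1.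

Fixpoint kexp n x y : R := if n is n'.+1 then kmul t (kexp n') x y else (x == y)%:R.

Lemma kexpD i j x y : kexp (i + j) x y = kmul (kexp i) (kexp j) x y.
Proof.
elim: i x => [|i IH] x /=.
  rewrite /kmul (bigD1 x) //= eqxx mul1r big1 ?addr0 // => z zx.
  by rewrite eq_sym (negPf zx) mul0r.
rewrite -kmulA; apply: eq_bigr => z _; congr (_ * _); exact: IH.
Qed.

Lemma kexp_sym i x y : kexp i x y = kexp i y x.
Proof.
elim: i x y => [|i IH] x y /=; first by rewrite eq_sym.
have -> : kmul t (kexp i) y x = kexp (i + 1) y x by rewrite addn1.
rewrite kexpD; apply: eq_bigr => z _; rewrite mulrC IH; congr (_ * _).
rewrite /= /kmul (bigD1 x) //= eqxx mulr1 big1 ?addr0 // => u ux.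
by rewrite (negPf ux) mulr0.
Qed.

Lemma kexp_ge0 i x y : 0 <= kexp i x y.
Proof.
elim: i x => [|i IH] x /=; first by case: (x == y).
by apply: sumr_ge0 => z _; exact: mulr_ge0.
Qed.

Lemma kexp_row i x : \sum_y kexp i x y = 1.
Proof.
elim: i x => [|i IH] x /=.
  by rewrite (bigD1 x) //= eqxx big1 ?addr0 // => y yx; rewrite eq_sym (negPf yx).
rewrite /kmul exchange_big /= -[RHS](t_row x); apply: eq_bigr => z _.
by rewrite -mulr_sumr IH mulr1.
Qed.

Lemma kexp_le1 i x y : kexp i x y <= 1.
Proof.
by rewrite -(kexp_row i x) (bigD1 y) //= lerDl; apply: sumr_ge0 => z _; exact: kexp_ge0.
Qed.

Definition kavg n x y := n%:R^-1 * \sum_(i < n) kexp i x y.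

Lemma kavg_ge0 n x y : 0 <= kavg n x y.
Proof. by rewrite mulr_ge0 ?invr_ge0 //; apply: sumr_ge0 => i _; exact: kexp_ge0. Qed.

Lemma kavg_sym n x y : kavg n x y = kavg n y x.
Proof. by congr (_ * _); apply: eq_bigr => i _; exact: kexp_sym. Qed.

Lemma kavg_le1 n x y : kavg n x y <= 1.
Proof.
case: n => [|n]; first by rewrite /kavg invr0 mul0r.
rewrite ler_pdivrMl // mulr1.
rewrite -[X in _ <= X%:R]card_ord -sumr_const; apply: ler_sum => i _; exact: kexp_le1.
Qed.

Let sum_kexp_shift n j x y : (j <= n)%N ->
  \sum_(i < n) kexp (i + j) x y <= \sum_(i < 2 * n) kexp i x y.
Proof.
move=> jn; rewrite -(big_mkord predT (fun i => kexp (i + j) x y)).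
rewrite -(big_mkord predT (fun i => kexp i x y)).
have -> : \sum_(0 <= i < n) kexp (i + j) x y = \sum_(j <= i < n + j) kexp i x y.
  by rewrite -{2}[j]add0n big_addn addnK.
rewrite [leRHS](@big_cat_nat _ _ _ j) //=; last by move: jn; clear; lia.
rewrite [X in _ + X](@big_cat_nat _ _ _ (n + j)) ?leq_addl //=; last by move: jn; clear; lia.
rewrite addrCA lerDl addr_ge0 //; apply: sumr_ge0 => i _; exact: kexp_ge0.
Qed.

(** The longer average dominates: if j <= i, every window [b, b + i) with b < j lies in [0, 2 i), so
    the composition is at most twice the average of length 2 i. The sum of both candidates on the
    right makes the bound symmetric in n and m. *)
Lemma kavg_comp_le n m x y : (0 < n)%N -> (0 < m)%N ->
  kmul (kavg n) (kavg m) x y <= 2 * (kavg (2 * n) x y + kavg (2 * m) x y).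
Proof.
have E i j : kmul (kavg i) (kavg j) x y =
    (i%:R * j%:R)^-1 * \sum_(a < i) \sum_(b < j) kexp (a + b) x y.
  rewrite /kmul /kavg invfM; under eq_bigr do rewrite mulrACA mulr_suml.
  rewrite -mulr_sumr exchange_big /=; congr (_ * _).
  apply: eq_bigr => a _; under eq_bigr do rewrite mulr_sumr.
  rewrite exchange_big /=; apply: eq_bigr => b _; by rewrite kexpD.
have key i j : (0 < j <= i)%N -> kmul (kavg i) (kavg j) x y <= 2 * kavg (2 * i) x y.
  move=> /andP[j0 ji]; have i0 := leq_trans j0 ji.
  have i0' : 0 < i%:R :> R by rewrite ltr0n.
  have j0' : 0 < j%:R :> R by rewrite ltr0n.
  rewrite E exchange_big /= ler_pdivrMl ?mulr_gt0 //.
  apply: (@le_trans _ _ (\sum_(b < j) \sum_(a < 2 * i) kexp a x y)).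
    apply: ler_sum => b _; apply: sum_kexp_shift.
    by apply: ltnW; apply: leq_trans ji.
  rewrite sumr_const card_ord -[_ *+ j]mulr_natl /kavg natrM.
  by rewrite le_eqVlt; apply/orP; left; apply/eqP; field; rewrite gt_eqF.
have [nm|mn] := leqP m n => n0 m0.
  apply: le_trans (key n m _) _; first by rewrite m0.
  by rewrite ler_pM2l // lerDl kavg_ge0.
have -> : kmul (kavg n) (kavg m) x y = kmul (kavg m) (kavg n) x y.
  rewrite !E [m%:R * _]mulrC exchange_big /=; congr (_ * _).
  by apply: eq_bigr => a _; apply: eq_bigr => b _; rewrite addnC.
apply: le_trans (key m n _) _; first by rewrite n0 ltnW.
by rewrite ler_pM2l // lerDr kavg_ge0.
Qed.

Let op k f x := \sum_y k x y * f y.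

(** The maximal operator is linearised: a supremum over lengths is a choice of a length [nu x] at
    each point, with a bound uniform in [nu]. *)
Let max_bound Q := forall nu f, (forall x, (0 < nu x)%N) -> (forall x, 0 <= f x) ->
  \sum_x op (kavg (nu x)) f x ^+ 2 <= Q * \sum_x f x ^+ 2.

Let max_bound_card : max_bound (#|X|%:R ^+ 2).
Proof.
move=> nu f nu0 f0.
apply: (@le_trans _ _ (\sum_(x : X) (\sum_y f y) ^+ 2)).
  apply: ler_sum => x _; rewrite lerXn2r ?nnegrE ?sumr_ge0 //.
    by move=> y _; rewrite mulr_ge0 // kavg_ge0.
  by apply: ler_sum => y _; rewrite ler_piMl // kavg_le1.
rewrite sumr_const -[_ *+ _]mulr_natl expr2 -mulrA ler_wpM2l //.
have := cauchy_schwarz_sum (index_enum X) (fun=> 1) f.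
under eq_bigr do rewrite mul1r; move/le_trans; apply.
by rewrite expr1n sumr_const.
Qed.

(* TT^*: the adjoint of the linearised maximal operator satisfies
   |B^* g|^2 <= 4 <g, B' g>, where B' is the linearised maximal operator
   with all the lengths doubled. *)
Let max_bound_step r : 0 <= r -> max_bound (16 * r ^+ 2) -> max_bound (16 * r).
Proof.
move=> r0 bd nu f nu0 f0; set B := fun x => op (kavg (nu x)) f x.
have adj g : (forall x, 0 <= g x) ->
    \sum_y (\sum_x g x * kavg (nu x) x y) ^+ 2 <= 16 * r * \sum_x g x ^+ 2.
  move=> g0; set L := \sum_y _.
  have h1 : L <= 4 * \sum_x g x * op (kavg (2 * nu x)) g x.
    have -> : L = \sum_x \sum_z g x * g z * kmul (kavg (nu x)) (kavg (nu z)) x z.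
      rewrite /L; under eq_bigr do rewrite expr2 mulr_suml.
      rewrite exchange_big /=; apply: eq_bigr => x _.
      under eq_bigr do rewrite mulr_sumr.
      rewrite exchange_big /=; apply: eq_bigr => z _.
      rewrite /kmul mulr_sumr; apply: eq_bigr => y _.
      by rewrite mulrACA [kavg _ z y]kavg_sym.
    apply: (@le_trans _ _ (\sum_x \sum_z (2 * (g x * (kavg (2 * nu x) x z * g z)) +
       2 * (g z * (kavg (2 * nu z) z x * g x))))).
      apply: ler_sum => x _; apply: ler_sum => z _.
      apply: le_trans (ler_wpM2l _ (kavg_comp_le _ _ (nu0 x) (nu0 z))) _.
        exact: mulr_ge0.
      by rewrite [kavg _ z x]kavg_sym; lra.
    under eq_bigr do rewrite big_split /=.
    rewrite big_split /= [X in _ + X]exchange_big /=.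
    under eq_bigr do rewrite -mulr_sumr -mulr_sumr.
    by rewrite -mulr_sumr /op; lra.
  have L0 : 0 <= L by apply: sumr_ge0 => y _; exact: sqr_ge0.
  have G0 : 0 <= \sum_x g x ^+ 2 by apply: sumr_ge0 => y _; exact: sqr_ge0.
  rewrite -(@ler_pXn2r _ 2) ?nnegrE ?mulr_ge0 //.
  apply: (@le_trans _ _ (16 * (\sum_x g x * op (kavg (2 * nu x)) g x) ^+ 2)).
    have -> : 16 = 4 ^+ 2 :> R by ring.
    rewrite -exprMn lerXn2r ?nnegrE //.
    by apply: le_trans L0 _.
  have -> : (16 * r * \sum_x g x ^+ 2) ^+ 2 =
    16 * ((\sum_x g x ^+ 2) * (16 * r ^+ 2 * \sum_x g x ^+ 2)) by ring.
  rewrite ler_pM2l //; apply: le_trans (cauchy_schwarz_sum _ _ _) _.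
  rewrite ler_wpM2l //; apply: (bd (fun x => 2 * nu x)%N) => // x.
  by rewrite muln_gt0 nu0.
have B0 x : 0 <= B x by apply: sumr_ge0 => y _; rewrite mulr_ge0 ?kavg_ge0.
set S := \sum_x _ ^+ 2; set F := \sum_x _ ^+ 2.
have S0 : 0 <= S by apply: sumr_ge0 => y _; exact: sqr_ge0.
have F0 : 0 <= F by apply: sumr_ge0 => y _; exact: sqr_ge0.
(* Duality: S is the pairing of f with the adjoint applied to B, so Cauchy-Schwarz and [adj] bound
   its square; dividing by S finishes. *)
have h : S ^+ 2 <= (16 * r * S) * F.
  have {1}-> : S = \sum_y (\sum_x B x * kavg (nu x) x y) * f y.
    under eq_bigr do rewrite mulr_suml.
    rewrite exchange_big /=; apply: eq_bigr => x _.
    rewrite -/(B x) expr2 {2}/B /op mulr_sumr; apply: eq_bigr => y _.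
    by rewrite mulrA.
  apply: le_trans (cauchy_schwarz_sum _ _ _) _.
  by rewrite ler_wpM2r //; exact: (adj B B0).
have [->|Sn] := eqVneq S 0; first by rewrite !mulr_ge0.
by rewrite -(@ler_pM2l _ S) ?lt0r ?Sn // -expr2 (le_trans h) // mulrCA mulrA.
Qed.

(* The map Q = 16 r^2 |-> 16 r has fixed point 16, so iterating it from the
   trivial bound |X|^2 gives a bound that does not depend on X. *)
Theorem maximal_ergodic nu f : (forall x, (0 < nu x)%N) -> (forall x, 0 <= f x) ->
  \sum_x (\sum_y kavg (nu x) x y * f y) ^+ 2 <= 32 * \sum_x f x ^+ 2.
Proof.
(* [max_bound_step] with r = 2^(2^j) lowers the exponent from j + 1 to j, and j = 0 gives 32. The
   start j = |X| is large enough because |X|^2 <= 2^(2^|X|). *)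
suff h j : max_bound (16 * 2 ^+ (2 ^ j)) -> max_bound 32.
  apply: (h #|X|) => mu g mu0 g0; apply: le_trans (max_bound_card mu0 g0) _.
  rewrite ler_wpM2r ?sumr_ge0 // => [x _|]; first exact: sqr_ge0.
  apply: (@le_trans _ _ (2 ^+ (2 ^ #|X|))); last by rewrite ler_peMl ?exprn_ge0 // ler1n.
  rewrite -!natrX ler_nat; case: #|X| => // n.
  apply: (@leq_trans ((2 ^ n.+1) ^ 2)); first by rewrite leq_exp2r // ltnW // ltn_expl.
  by rewrite -expnM leq_exp2l // expnS mulnC leq_mul2l ltn_expl.
elim: j => [|j IH]; first by rewrite expr1 (_ : 16 * 2 = 32 :> R) //; lra.
by move=> bd; apply: IH; apply: max_bound_step; rewrite ?exprn_ge0 // -exprM mulnC -expnS.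
Qed.

End MaximalErgodic.

(** * The Hartley transform on (Z/N)^d *)

Section Hartley.
Context {R : realType} (N : nat).
Local Notation Z := 'I_N.+2.

Definition angle (a : Z) : R := a%:R * (pi *+ 2 / N.+2%:R).

Let angle_mod n :
  exists q, n%:R * (pi *+ 2 / N.+2%:R) = angle (inZp n) + (pi *+ 2) *+ q :> R.
Proof.
exists (n %/ N.+2)%N; rewrite /angle /=.
by rewrite {1}(divn_eq n N.+2) natrD natrM -[_ *+ (_ %/ _)%N]mulr_natl; field.
Qed.

Let cos_inZp n : cos (angle (inZp n)) = cos (n%:R * (pi *+ 2 / N.+2%:R)) :> R.
Proof. by have [q ->] := angle_mod n; rewrite periodicn //; exact: cosD2pi. Qed.

Let sin_inZp n : sin (angle (inZp n)) = sin (n%:R * (pi *+ 2 / N.+2%:R)) :> R.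
Proof. by have [q ->] := angle_mod n; rewrite periodicn //; exact: sinD2pi. Qed.

Let addE (a b : Z) : a + b = inZp (a + b)%N. Proof. exact: val_inj. Qed.

Let oppE (a : Z) : - a = inZp (N.+2 - a)%N. Proof. exact: val_inj. Qed.

Lemma cos_angleD a b : cos (angle (a + b)) =
  cos (angle a) * cos (angle b) - sin (angle a) * sin (angle b).
Proof. by rewrite addE cos_inZp natrD mulrDl cosD. Qed.

Lemma sin_angleD a b : sin (angle (a + b)) =
  sin (angle a) * cos (angle b) + cos (angle a) * sin (angle b).
Proof. by rewrite addE sin_inZp natrD mulrDl sinD. Qed.

Let angleN_eq (a : Z) :
  (N.+2 - a)%N%:R * (pi *+ 2 / N.+2%:R) = - angle a + pi *+ 2 :> R.
Proof. by rewrite natrB 1?ltnW // /angle; field. Qed.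

Lemma cos_angleN a : cos (angle (- a)) = cos (angle a).
Proof. by rewrite oppE cos_inZp angleN_eq cosD2pi cosN. Qed.

Lemma sin_angleN a : sin (angle (- a)) = - sin (angle a).
Proof. by rewrite oppE sin_inZp angleN_eq sinD2pi sinN. Qed.

Lemma angle0 : angle 0 = 0. Proof. by rewrite /angle mul0r. Qed.

Let angle_mulrn a n : cos (angle (a *+ n)) = cos (n%:R * angle a) /\
  sin (angle (a *+ n)) = sin (n%:R * angle a).
Proof.
elim: n => [|n [IHc IHs]]; first by rewrite mulr0n angle0 mul0r.
by rewrite mulrSr cos_angleD sin_angleD -natr1 mulrDl mul1r cosD sinD IHc IHs.
Qed.

Lemma cos_angle_mulrz a (n : int) : cos (angle (a *~ n)) = cos (n%:~R * angle a).
Proof.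
case: n => n; first by rewrite -pmulrn (angle_mulrn a n).1.
by rewrite NegzE mulrNz cos_angleN -pmulrn (angle_mulrn a n.+1).1 mulrNz mulNr cosN.
Qed.

Lemma sin_angle_mulrz a (n : int) : sin (angle (a *~ n)) = sin (n%:~R * angle a).
Proof.
case: n => n; first by rewrite -pmulrn (angle_mulrn a n).2.
by rewrite NegzE mulrNz sin_angleN -pmulrn (angle_mulrn a n.+1).2 mulrNz mulNr sinN.
Qed.

Lemma cos_angle_eq1 a : cos (angle a) = 1 -> a = 0.
Proof.
move=> h; apply/eqP; apply: contraT => a0.
have {}a0 : (0 < a)%N by rewrite lt0n.
have n0 : 0 < N.+2%:R :> R by rewrite ltr0n.
have : 0 < sin (a%:R * (pi / N.+2%:R)) :> R.
  apply: sin_gt0_pi; rewrite mulr_gt0 ?divr_gt0 ?pi_gt0 ?ltr0n //=.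
  by rewrite mulrCA gtr_pMr ?pi_gt0 // ltr_pdivrMr // mul1r ltr_nat.
suff -> : sin (a%:R * (pi / N.+2%:R)) = 0 :> R by rewrite ltxx.
apply/eqP; rewrite -sqrf_eq0; apply/eqP.
have := h; rewrite /angle (_ : _ * _ = (a%:R * (pi / N.+2%:R)) *+ 2); last first.
  by rewrite -mulrnAr -mulrnAl.
by rewrite cos_mulr2n cos2sin2 => e; lra.
Qed.

Context {d : nat}.
Local Notation X := 'rV[Z]_d.
Implicit Types (k x y : X) (f w : X -> R).

Definition dotz k x : Z := \sum_i k ord0 i * x ord0 i.

Lemma dotzDr k x y : dotz k (x + y) = dotz k x + dotz k y.
Proof. by rewrite -big_split; apply: eq_bigr => i _; rewrite mxE mulrDr. Qed.

Lemma dotzNr k x : dotz k (- x) = - dotz k x.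
Proof. by rewrite -sumrN; apply: eq_bigr => i _; rewrite mxE mulrN. Qed.

Lemma dotzC k x : dotz k x = dotz x k.
Proof. by apply: eq_bigr => i _; rewrite mulrC. Qed.

(** The kernel cos + sin replaces the complex exponential and keeps all functions real. Parseval's
    identity survives, and convolution with an even function still acts by multiplication. *)
Definition cas k x : R := cos (angle (dotz k x)) + sin (angle (dotz k x)).

Definition hartley f k := \sum_x f x * cas k x.

Let sum_sin v : \sum_k sin (angle (dotz k v)) = 0 :> R.
Proof.
have : \sum_k sin (angle (dotz k v)) = - \sum_k sin (angle (dotz k v)) :> R.
  rewrite {1}(reindex_inj oppr_inj) -sumrN; apply: eq_bigr => k _.
  by rewrite dotzC dotzNr sin_angleN dotzC.
by move=> h; lra.
Qed.

(** If [v ord0 i] is nonzero, translating k by the i-th unit vector multiplies the sum by the cosine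
    of its angle, which is not 1; the sine part vanishes by oddness. So the sum is 0. *)
Let sum_cos v : \sum_k cos (angle (dotz k v)) = (v == 0)%:R * #|X|%:R :> R.
Proof.
have [->|v0] := eqVneq v 0.
  rewrite mul1r -[RHS]sumr_const; apply: eq_bigr => k _.
  by rewrite /dotz big1 ?angle0 ?cos0 // => i _; rewrite mxE mulr0.
rewrite mul0r; set S := \sum_k _.
have /existsP[i vi] : [exists i, v ord0 i != 0].
  apply: contraNT v0; rewrite negb_exists => /forallP h.
  by apply/eqP/rowP => i; rewrite mxE; apply/eqP; have := h i; rewrite negbK.
have : S = S * cos (angle (v ord0 i)).
  rewrite {1}/S (reindex_inj (addIr (delta_mx ord0 i : X))) /=.
  have E k : dotz (k + delta_mx ord0 i) v = dotz k v + v ord0 i.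
    rewrite dotzC dotzDr dotzC; congr (_ + _).
    rewrite /dotz (bigD1 i) //= mxE !eqxx mulr1 big1 ?addr0 // => j ji.
    by rewrite mxE eqxx /= (negPf ji) mulr0.
  under eq_bigr do rewrite E cos_angleD.
  by rewrite sumrB -!mulr_suml sum_sin mul0r subr0.
move=> h; apply/eqP; apply: contraT => S0.
have /cos_angle_eq1 : cos (angle (v ord0 i)) = 1 by apply: (mulfI S0); rewrite -h mulr1.
by move/eqP; rewrite (negPf vi).
Qed.

Lemma hartley_parseval f : \sum_k hartley f k ^+ 2 = #|X|%:R * \sum_x f x ^+ 2.
Proof.
have -> : \sum_k hartley f k ^+ 2 =
    \sum_x \sum_y f x * f y * \sum_k (cas k x * cas k y).
  under eq_bigr do rewrite expr2 /hartley mulr_suml.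
  rewrite exchange_big /=; apply: eq_bigr => x _.
  under eq_bigr do rewrite mulr_sumr.
  rewrite exchange_big /=; apply: eq_bigr => y _.
  by rewrite mulr_sumr; apply: eq_bigr => k _; rewrite mulrACA.
rewrite mulr_sumr; apply: eq_bigr => x _.
have E y : \sum_k (cas k x * cas k y) = (x == y)%:R * #|X|%:R.
  have -> : \sum_k (cas k x * cas k y) =
     \sum_k (cos (angle (dotz k (x - y))) + sin (angle (dotz k (x + y)))).
    apply: eq_bigr => k _; rewrite !dotzDr dotzNr cos_angleD sin_angleD.
    by rewrite cos_angleN sin_angleN /cas; ring.
  by rewrite big_split /= sum_sin sum_cos addr0 subr_eq0.
rewrite (bigD1 x) //= E eqxx mul1r big1 ?addr0 => [|y yx].
  by rewrite mulrC expr2.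
by rewrite E eq_sym (negPf yx) mul0r mulr0.
Qed.

Definition conv w x y := w (x - y).

Definition transform w k := \sum_v w v * cos (angle (dotz k v)).

(** The addition formulas leave a cosine part and a sine part of w; the latter vanishes because w is
    even. *)
Lemma hartley_conv w f k : (forall v, w (- v) = w v) ->
  hartley (fun x => \sum_y conv w x y * f y) k = transform w k * hartley f k.
Proof.
move=> w_even; rewrite /hartley /conv.
under eq_bigr do rewrite mulr_suml.
rewrite exchange_big /= mulr_sumr; apply: eq_bigr => y _.
rewrite (reindex_inj (addIr y)) /= /transform.
under eq_bigr => v _.
  rewrite addrK /cas dotzDr cos_angleD sin_angleD.
  set c := cos _; set s := sin _; set c' := cos _; set s' := sin _.
  have -> : w v * f y * (c * c' - s * s' + (s * c' + c * s')) =
    w v * c * (f y * (c' + s')) + w v * s * (f y * (c' - s')) by ring.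
  rewrite {}/c {}/s {}/c' {}/s'; over.
rewrite big_split /= -!mulr_suml.
have -> : \sum_v w v * sin (angle (dotz k v)) = 0.
  set S := \sum_v _; have : S = - S.
    rewrite {1}/S (reindex_inj oppr_inj) -sumrN; apply: eq_bigr => v _.
    by rewrite dotzNr sin_angleN w_even mulrN.
  by move=> h; lra.
by rewrite mul0r addr0.
Qed.

Lemma hartleyB f g k : hartley (fun x => f x - g x) k = hartley f k - hartley g k.
Proof. by rewrite -sumrB; apply: eq_bigr => x _; rewrite mulrBl. Qed.

Lemma hartley_kexp w f i k : (forall v, w (- v) = w v) ->
  hartley (fun x => \sum_y kexp (conv w) i x y * f y) k =
  transform w k ^+ i * hartley f k.
Proof.
move=> w_even; elim: i => [|i IH].
  rewrite mul1r; apply: eq_bigr => x _; congr (_ * _).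
  rewrite (bigD1 x) //= eqxx mul1r big1 ?addr0 // => y yx.
  by rewrite eq_sym (negPf yx) mul0r.
rewrite exprS -mulrA -IH -hartley_conv //; apply: eq_bigr => x _; congr (_ * _).
rewrite /= /kmul; under eq_bigr do rewrite mulr_suml.
rewrite exchange_big /=; apply: eq_bigr => y _; rewrite mulr_sumr.
by apply: eq_bigr => z _; rewrite mulrA.
Qed.

End Hartley.

(** * Spheres in (Z/N)^d *)

Section Box.
Context {R : realType} (M : nat) {d : nat}.
Local Notation J := 'I_(2 * M).+1.
Local Notation Y := {ffun 'I_d -> J}.
Implicit Types (j : J) (y : Y) (i : 'I_d).

(** This makes [{ffun 'I_d -> J}] a finite model of the cube [-M, M]^d, which contains every sphere
    of radius at most M. *)
Definition centered j : int := j%:Z - M%:Z.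

Definition box_norm y : nat := \sum_i `|centered (y i)|%N.

Lemma centered_rev j : centered (rev_ord j) = - centered j.
Proof. by rewrite /centered /=; have := ltn_ord j; lia. Qed.

Let flip i y : Y := [ffun l => if l == i then rev_ord (y l) else y l].

Let flipK i : involutive (flip i).
Proof.
by move=> y; apply/ffunP => l; rewrite !ffunE; case: eqP => // _; rewrite rev_ordK.
Qed.

Let box_norm_flip i y : box_norm (flip i y) = box_norm y.
Proof.
apply: eq_bigr => l _; rewrite ffunE; case: eqP => // _.
by rewrite centered_rev abszN.
Qed.

Variable th : 'I_d -> R.
Let phase y i : R := (centered (y i))%:~R * th i.

Let phase_flip i y : phase (flip i y) i = - phase y i.
Proof. by rewrite /phase ffunE eqxx centered_rev mulrNz mulNr. Qed.

Let phase_flip_neq i l y : l != i -> phase (flip i y) l = phase y l.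
Proof. by move=> li; rewrite /phase ffunE (negPf li). Qed.

(** The spheres are invariant under sign flips of single coordinates, and a flip negates the term
    with [sin (phase y i)]. The invariant weight g collects the cosines already split off during the
    induction. *)
Let sum_cos_phase n (s : seq 'I_d) (g : Y -> R) : uniq s ->
  (forall i y, i \in s -> g (flip i y) = g y) ->
  \sum_(y | box_norm y == n) g y * cos (\sum_(i <- s) phase y i) =
  \sum_(y | box_norm y == n) g y * \prod_(i <- s) cos (phase y i).
Proof.
elim: s g => [|i s IH] g /=.
  by move=> _ _; apply: eq_bigr => y _; rewrite !big_nil cos0.
move=> /andP[is_ us] hg.
have rest y : \sum_(l <- s) phase (flip i y) l = \sum_(l <- s) phase y l.
  rewrite big_seq [RHS]big_seq; apply: eq_bigr => l ls.
  by rewrite phase_flip_neq //; apply: contraNneq is_ => <-.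
under eq_bigr do rewrite big_cons cosD mulrBr [g _ * (cos _ * _)]mulrA.
rewrite sumrB IH //; last first.
  move=> l y ls; rewrite hg ?inE ?ls ?orbT // phase_flip_neq //.
  by apply: contraNneq is_ => ->.
set S := \sum_(y | _) g y * (sin _ * _).
have -> : S = 0.
  have : S = - S.
    rewrite {1}/S (reindex_inj (can_inj (flipK i))) -sumrN.
    apply: eq_big => y; first by rewrite box_norm_flip.
    by move=> _; rewrite hg ?mem_head // phase_flip rest sinN; ring.
  by move=> h; lra.
by rewrite subr0; apply: eq_bigr => y _; rewrite big_cons mulrA.
Qed.

Let sphere1_gfE (x : R) :
  sphere1_gf M x = \sum_j cos ((centered j)%:~R * x) *: 'X^(`|centered j|%N).
Proof.
apply/polyP => r; rewrite coef_poly coef_sum ltnS.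
under eq_bigr do rewrite coefZ coefXn.
have bnd j : (`|centered j| <= M)%N by rewrite /centered; have := ltn_ord j; lia.
have [rM|Mr] := leqP r M; last first.
  rewrite big1 // => j _; rewrite eqn_leq.
  by rewrite leqNgt (leq_ltn_trans (bnd j) Mr) mulr0.
(* Only the coordinates r and -r contribute to the coefficient; they coincide for r = 0, where
   [sphere1] is 1 instead of a doubled cosine. *)
pose j1 : J := inord (M + r); pose j2 : J := inord (M - r).
have c1 : centered j1 = r%:Z by rewrite /centered inordK; lia.
have c2 : centered j2 = - r%:Z by rewrite /centered inordK; lia.
rewrite (bigD1 j1) //= c1 absz_nat eqxx mulr1.
case: r rM @j1 @j2 c1 c2 => [|r] rM j1 j2 c1 c2.
  rewrite mul0r cos0 big1 ?addr0 // => j jj.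
  suff /negPf -> : 0%N != `|centered j|%N by rewrite mulr0.
  apply: contra jj => /eqP e; apply/eqP/val_inj; rewrite /= inordK; last lia.
  by move: e; rewrite /centered; lia.
have j21 : j2 != j1.
  by apply/eqP => e; move: c1 c2; rewrite e => ->; lia.
rewrite (bigD1 j2) //= c2 abszN absz_nat eqxx mulr1 mulrNz mulNr cosN.
rewrite big1 ?addr0 => [|j /andP[jj1 jj2]]; first by rewrite /sphere1 /=; lra.
suff /negPf -> : r.+1 != `|centered j|%N by rewrite mulr0.
apply/negP => /eqP e; have [cj|cj] := leP 0 (centered j).
  case/negP: jj1; apply/eqP/val_inj; rewrite /= inordK; last lia.
  by move: e cj; rewrite /centered; lia.
case/negP: jj2; apply/eqP/val_inj; rewrite /= inordK; last lia.
by move: e cj; rewrite /centered; lia.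
Qed.

(** Expanding the product over the coordinates yields products of cosines, which the sign flips turn
    into the cosine of the sum, that is, the real part of a character. *)
Lemma sphere_gf_cos n : (sphere_gf M th)`_n =
  \sum_(y : Y | box_norm y == n) cos (\sum_i (centered (y i))%:~R * th i).
Proof.
rewrite /sphere_gf; under eq_bigr do rewrite sphere1_gfE.
rewrite bigA_distr_bigA coef_sum.
have := @sum_cos_phase n (index_enum 'I_d) (fun=> 1) (index_enum_uniq _) (fun _ _ _ => erefl).
under eq_bigr do rewrite mul1r; move=> ->.
rewrite [RHS]big_mkcond /=; apply: eq_bigr => y _.
have -> : \prod_(i < d) (cos ((centered (y i))%:~R * th i) *: 'X^(`|centered (y i)|%N))
   = (\prod_(i < d) cos (phase y i)) *: 'X^(box_norm y) :> {poly R}.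
  rewrite /box_norm; elim/big_rec3: _ => [|i a b c _ ->]; first by rewrite scale1r expr0.
  by rewrite exprD -scalerAl -scalerAr scalerA.
by rewrite coefZ coefXn eq_sym; case: eqP; rewrite ?mulr1 ?mulr0 // mul1r.
Qed.

End Box.

Lemma sphere_countE (R : realType) (M d n : nat) :
  @sphere_count R M d n = #|[pred y : {ffun 'I_d -> 'I_(2 * M).+1} | box_norm y == n]|%:R.
Proof.
rewrite /sphere_count sphere_gf_cos -sum1_card natr_sum; apply: eq_big => // y _.
by rewrite big1 ?cos0 // => i _; rewrite mulr0.
Qed.

Section SphereDensity.
Context {R : realType} (M N : nat) {d : nat}.
Local Notation J := 'I_(2 * M).+1.
Local Notation Y := {ffun 'I_d -> J}.
Local Notation Z := 'I_N.+2.
Local Notation X := 'rV[Z]_d.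

Definition box_proj (y : Y) : X := \row_i (centered (y i))%:~R.

(** The image on the torus of the uniform measure on the sphere; it counts preimages since distinct
    points may become equal modulo N + 2. *)
Definition sphere_density n (v : X) : R :=
  (\sum_(y : Y | box_norm y == n) (box_proj y == v)%:R) / @sphere_count R M d n.

Let sum_density n (F : X -> R) : \sum_v sphere_density n v * F v =
  (\sum_(y : Y | box_norm y == n) F (box_proj y)) / @sphere_count R M d n.
Proof.
under eq_bigr do rewrite mulrAC mulr_suml.
rewrite -mulr_suml exchange_big /=; congr (_ / _); apply: eq_bigr => y _.
rewrite (bigD1 (box_proj y)) //= eqxx mul1r big1 ?addr0 // => v vy.
by rewrite eq_sym (negPf vy) mul0r.
Qed.

Lemma sphere_density_ge0 n v : 0 <= sphere_density n v.
Proof. by rewrite divr_ge0 ?sphere_countE // sumr_ge0. Qed.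

Lemma sphere_densityN n v : sphere_density n (- v) = sphere_density n v.
Proof.
pose rv (y : Y) : Y := [ffun i => rev_ord (y i)].
have rvK : involutive rv by move=> y; apply/ffunP => i; rewrite !ffunE rev_ordK.
congr (_ / _); rewrite (reindex_inj (can_inj rvK)); apply: eq_big => y.
  by congr (_ == _); apply: eq_bigr => i _; rewrite ffunE centered_rev abszN.
move=> _; rewrite -(inj_eq oppr_inj (box_proj y)); congr ((_ == _)%:R).
by apply/rowP => i; rewrite !mxE ffunE centered_rev mulrNz.
Qed.

Lemma sphere_op n (f : X -> R) x :
  \sum_v conv (sphere_density n) x v * f v =
  (\sum_(y : Y | box_norm y == n) f (x - box_proj y)) / @sphere_count R M d n.
Proof.
rewrite -(sum_density n (fun v => f (x - v))).
rewrite (reindex_inj (inv_inj (subKr x))); apply: eq_bigr => v _.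
by rewrite /conv subKr.
Qed.

Lemma box_norm_inhab n : (0 < d)%N -> (n <= M)%N -> exists y : Y, box_norm y = n.
Proof.
case: d => // d' _ nM.
exists [ffun i => inord (if i == ord0 then M + n else M)].
rewrite /box_norm (bigD1 ord0) //= ffunE /centered inordK ?big1; try lia.
  by move=> i /negPf i0; rewrite ffunE i0 /centered inordK; lia.
Qed.

Lemma sphere_count_pos n : (0 < d)%N -> (n <= M)%N -> 0 < @sphere_count R M d n.
Proof.
move=> d0 nM; rewrite sphere_countE ltr0n; apply/card_gt0P.
by have [y yn] := @box_norm_inhab n d0 nM; exists y; rewrite inE yn.
Qed.

Lemma sphere_density_sum n : (0 < d)%N -> (n <= M)%N ->
  \sum_v sphere_density n v = 1.
Proof.
move=> d0 nM; have := sum_density n (fun=> 1); under eq_bigr do rewrite mulr1.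
move=> ->; rewrite sumr_const -sphere_countE divff // gt_eqF //.
exact: sphere_count_pos.
Qed.

Lemma transform_sphere_density n (k : X) :
  transform (sphere_density n) k = multiplier M (fun i => angle (k ord0 i)) n.
Proof.
rewrite /transform sum_density /multiplier sphere_gf_cos; congr (_ / _).
apply: eq_bigr => y _.
(* Cosine and sine go through the induction together, as the addition formulas mix them. *)
suff [] : cos (angle (dotz k (box_proj y))) =
    cos (\sum_i (centered (y i))%:~R * angle (k ord0 i)) :> R /\
  sin (angle (dotz k (box_proj y))) =
    sin (\sum_i (centered (y i))%:~R * angle (k ord0 i)) :> R by [].
rewrite /dotz; elim/big_rec2: _ => [|i t z _ [hc hs]]; first by rewrite angle0.
rewrite cos_angleD sin_angleD hc hs mxE mulrzr.
by rewrite cos_angle_mulrz sin_angle_mulrz cosD sinD.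
Qed.

End SphereDensity.

(** * The maximal inequality in l^2 *)

(** The differences have step two because for lambda near -1 consecutive multipliers nearly
    alternate in sign, and only those at distance two are close. *)
Lemma summation_by_parts_le (R : realFieldType) (b : nat -> R) n :
  (forall i, 0 <= b i) ->
  n%:R * b n <= 3 * (\sum_(i < n.+1) b i) +
    \sum_(2 <= j < n.+1) j%:R * `|b j - b (j - 2)%N|.
Proof.
move=> b0; case: n => [|n].
  by rewrite mul0r addr_ge0 ?mulr_ge0 ?sumr_ge0 // => i _; rewrite mulr_ge0.
have E : n.+1%:R * b n.+1 + n%:R * b n =
    \sum_(2 <= j < n.+2) j%:R * (b j - b (j - 2)%N) + 2 * (\sum_(i < n) b i) + b 1.
  elim: n => [|n IH]; first by rewrite big_geq // big_ord0 mul0r mulr0; ring.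
  rewrite big_nat_recr //= big_ord_recr /= subSS subn1 /=.
  move: IH; rewrite -[n.+2%:R]natr1 -[n.+1%:R]natr1 => IH.
  by lra.
have h1 : \sum_(2 <= j < n.+2) j%:R * (b j - b (j - 2)%N) <=
    \sum_(2 <= j < n.+2) j%:R * `|b j - b (j - 2)%N|.
  by apply: ler_sum => j _; rewrite ler_wpM2l // ler_norm.
have h2 : \sum_(i < n) b i <= \sum_(i < n.+2) b i.
  by rewrite 2!big_ord_recr /= -addrA lerDl addr_ge0.
have h3 : b 1 <= \sum_(i < n.+2) b i.
  by rewrite (bigD1 (lift ord0 ord0)) //= lerDl sumr_ge0.
have : 0 <= n%:R * b n by rewrite mulr_ge0.
lra.
Qed.

Lemma sqr_sum3_le (R : realFieldType) (a b c : R) :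
  (a + b + c) ^+ 2 <= 3 * (a ^+ 2 + b ^+ 2 + c ^+ 2).
Proof.
have := sqr_ge0 (a - b); have := sqr_ge0 (a - c); have := sqr_ge0 (b - c).
by rewrite !expr2; lra.
Qed.

Lemma sum_nat_le_sqr n : (\sum_(1 <= i < n.+1) i <= n ^ 2)%N.
Proof.
elim: n => [|n IH]; first by rewrite big_geq.
by rewrite big_nat_recr //= (leq_trans (leq_add IH (leqnn _))) // -!mulnn; lia.
Qed.

Lemma cauchy_schwarz_weight (R : rcfType) (I : Type) (r : seq I) (c a : I -> R) :
  (forall i, 0 <= c i) ->
  (\sum_(i <- r) c i * a i) ^+ 2 <=
  (\sum_(i <- r) c i) * (\sum_(i <- r) c i * a i ^+ 2).
Proof.
move=> c0; have E i : c i = Num.sqrt (c i) ^+ 2 by rewrite sqr_sqrtr.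
under eq_bigr do rewrite E expr2 -mulrA.
apply: le_trans (cauchy_schwarz_sum _ _ _) _.
rewrite le_eqVlt; apply/orP; left; apply/eqP; congr (_ * _).
  by apply: eq_bigr => i _; rewrite -E.
by apply: eq_bigr => i _; rewrite exprMn -E.
Qed.

Lemma sqr_sum_natl_le (R : rcfType) (a : nat -> R) m n M :
  (0 < m)%N -> (n <= M)%N ->
  (\sum_(m <= i < n.+1) i%:R * a i) ^+ 2 <=
  n%:R ^+ 2 * \sum_(m <= i < M.+1) i%:R * a i ^+ 2.
Proof.
move=> m0 nM; apply: le_trans (cauchy_schwarz_weight _ _ _) _ => //.
have p i : 0 <= i%:R * a i ^+ 2 by rewrite mulr_ge0 ?sqr_ge0.
apply: ler_pM; rewrite ?sumr_ge0 //.
  rewrite -natr_sum -natrX ler_nat (leq_trans _ (sum_nat_le_sqr n)) //.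
  have [nm|mn] := leqP n.+1 m; first by rewrite big_geq.
  by rewrite (big_cat_nat m0 (ltnW mn)) //= leq_addl.
have [nm|mn] := leqP n.+1 m; first by rewrite big_geq // sumr_ge0.
by rewrite [leRHS](big_cat_nat (n := n.+1) (ltnW mn)) //= lerDl sumr_ge0.
Qed.

Section L2.
Context {R : realType} (M N : nat) {d : nat}.
Hypotheses (d_gt0 : (0 < d)%N) (M_gt0 : (0 < M)%N) (M_le : (500 * M <= d)%N).
Local Notation X := 'rV['I_N.+2]_d.
Implicit Types (f : X -> R) (nu : X -> nat).

Definition sphere_mean n f (x : X) : R :=
  \sum_v conv (@sphere_density R M N d n) x v * f v.

Let walk n f (x : X) : R :=
  \sum_v kexp (conv (@sphere_density R M N d 1)) n x v * f v.

Let m n (k : X) : R := multiplier M (fun i => angle (k ord0 i)) n.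

Let hartley_mean n f k : hartley (sphere_mean n f) k = m n k * hartley f k.
Proof.
rewrite hartley_conv ?transform_sphere_density // => v; exact: sphere_densityN.
Qed.

Let hartley_walk n f k : hartley (walk n f) k = m 1 k ^+ n * hartley f k.
Proof.
rewrite hartley_kexp ?transform_sphere_density // => v; exact: sphere_densityN.
Qed.

Let X_gt0 : 0 < #|X|%:R :> R.
Proof. by rewrite ltr0n; apply/card_gt0P; exists 0. Qed.

Let sum_sqr_hartley f : \sum_x f x ^+ 2 = #|X|%:R^-1 * \sum_k hartley f k ^+ 2.
Proof. by rewrite hartley_parseval mulKf ?gt_eqF. Qed.

(** By Plancherel a square function estimate reduces to a bound on the sum of squared multipliers at
    each single frequency. *)
Let multiplier_bound (I : Type) (r : seq I) (c : I -> R) (g : I -> X -> R)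
    (mu : I -> X -> R) C f :
  (forall i k, hartley (g i) k = mu i k * hartley f k) ->
  (forall k, \sum_(i <- r) c i * mu i k ^+ 2 <= C) ->
  \sum_x \sum_(i <- r) c i * g i x ^+ 2 <= C * \sum_x f x ^+ 2.
Proof.
move=> hg hC; rewrite exchange_big /=.
under eq_bigr do rewrite -mulr_sumr sum_sqr_hartley mulrCA.
rewrite -mulr_sumr sum_sqr_hartley mulrCA ler_wpM2l ?invr_ge0 //.
under eq_bigr do rewrite mulr_sumr.
rewrite exchange_big mulr_sumr /=; apply: ler_sum => k _.
under eq_bigr do rewrite hg exprMn mulrA.
by rewrite -mulr_suml ler_wpM2r ?sqr_ge0.
Qed.

Let sphere_mean_walk f : \sum_x \sum_(1 <= i < M.+1)
  i%:R^-1 * (sphere_mean i f x - walk i f x) ^+ 2 <= 4 * \sum_x f x ^+ 2.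
Proof.
apply: (multiplier_bound (mu := fun i k => m i k - m 1 k ^+ i)
  (g := fun i x => sphere_mean i f x - walk i f x)) => [i k|k].
  by rewrite hartleyB hartley_mean hartley_walk mulrBl.
under eq_bigr do rewrite mulrC.
exact: sum_sqr_sphere_multiplier_pow.
Qed.

Let sphere_mean_step2 f : \sum_x \sum_(2 <= i < M.+1)
  i%:R * (sphere_mean i f x - sphere_mean (i - 2)%N f x) ^+ 2
  <= 128 * \sum_x f x ^+ 2.
Proof.
apply: (multiplier_bound (mu := fun i k => m i k - m (i - 2)%N k)
  (g := fun i x => sphere_mean i f x - sphere_mean (i - 2)%N f x)) => [i k|k].
  by rewrite hartleyB !hartley_mean mulrBl.
exact: sum_sqr_sphere_multiplier_step2.
Qed.

Lemma sphere_mean0 f x : sphere_mean 0 f x = f x.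
Proof.
have : \sum_x (sphere_mean 0 f x - f x) ^+ 2 = 0.
  rewrite sum_sqr_hartley big1 ?mulr0 // => k _.
  by rewrite hartleyB hartley_mean /m multiplier0 mul1r subrr expr0n.
move/eqP; rewrite psumr_eq0 => [|y _]; last exact: sqr_ge0.
by move/allP/(_ x (mem_index_enum _)); rewrite /= sqrf_eq0 subr_eq0 => /eqP.
Qed.

Lemma sphere_mean_ge0 n f x : (forall y, 0 <= f y) -> 0 <= sphere_mean n f x.
Proof. by move=> f0; apply: sumr_ge0 => v _; rewrite mulr_ge0 // sphere_density_ge0. Qed.

(** At the chosen radius n the mean is compared with the Cesaro average A of length n + 1, with
    errors H and G. Their sums run up to M whatever the radius, so A, H and G can each be summed
    over x. *)
Theorem sphere_maximal_l2 nu f : (forall x, (nu x <= M)%N) -> (forall x, 0 <= f x) ->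
  \sum_x sphere_mean (nu x) f x ^+ 2 <= 64 ^+ 2 * \sum_x f x ^+ 2.
Proof.
move=> nuM f0; pose t := conv (@sphere_density R M N d 1).
pose A x := \sum_v kavg t (nu x).+1 x v * f v.
pose H x := \sum_(1 <= i < M.+1) i%:R^-1 * (sphere_mean i f x - walk i f x) ^+ 2.
pose G x := \sum_(2 <= i < M.+1)
  i%:R * (sphere_mean i f x - sphere_mean (i - 2)%N f x) ^+ 2.
have H0 x : 0 <= H x by apply: sumr_ge0 => i _; rewrite mulr_ge0 ?invr_ge0 ?sqr_ge0.
have G0 x : 0 <= G x by apply: sumr_ge0 => i _; rewrite mulr_ge0 ?sqr_ge0.
have AE x : (nu x).+1%:R * A x = \sum_(i < (nu x).+1) walk i f x.
  rewrite /A /kavg; under eq_bigr do rewrite -mulrA mulr_suml.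
  by rewrite -mulr_sumr exchange_big /= mulVKf ?pnatr_eq0.
(* The coefficients are 3 times the squares of the coefficients 6, 3 and 1 in [key]. *)
have pt x : sphere_mean (nu x) f x ^+ 2 <= 108 * A x ^+ 2 + 27 * H x + 3 * G x.
  have := AE x; have := nuM x; move: (A x) (nu x) => a n nM aE.
  (* The radius 0 is separate because [key] is divided by n; there [A x] is the mean itself. *)
  have [n0|n0] := posnP n.
    move: aE; rewrite n0 big_ord1 mul1r => ->.
    have -> : walk 0 f x = sphere_mean 0 f x.
      rewrite sphere_mean0 /walk (bigD1 x) //= eqxx mul1r big1 ?addr0 // => y yx.
      by rewrite eq_sym (negPf yx) mul0r.
    by have := H0 x; have := G0 x; have := sqr_ge0 (sphere_mean 0 f x); lra.
  pose U := \sum_(1 <= i < n.+1) `|sphere_mean i f x - walk i f x|.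
  pose V := \sum_(2 <= i < n.+1) i%:R * `|sphere_mean i f x - sphere_mean (i - 2)%N f x|.
  have hU : U ^+ 2 <= n%:R ^+ 2 * H x.
    (* The inserted weights i sum to at most n^2, and what remains after Cauchy-Schwarz is H. *)
    have -> : U = \sum_(1 <= i < n.+1) i%:R * (i%:R^-1 * `|sphere_mean i f x - walk i f x|).
      rewrite /U !big_nat; apply: eq_bigr => i /andP[i0 _].
      by rewrite mulVKf // pnatr_eq0 -lt0n.
    apply: le_trans (sqr_sum_natl_le _ _ nM) _ => //.
    rewrite ler_wpM2l ?sqr_ge0 // /H !big_nat; apply: ler_sum => i /andP[i0 _].
    rewrite exprMn real_normK ?num_real // mulrA expr2 mulVKf //.
    by rewrite pnatr_eq0 -lt0n.
  have hV : V ^+ 2 <= n%:R ^+ 2 * G x.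
    apply: le_trans (sqr_sum_natl_le _ _ nM) _ => //.
    rewrite ler_wpM2l ?sqr_ge0 //; apply: ler_sum => i _.
    by rewrite real_normK ?num_real.
  have U0 : 0 <= U by apply: sumr_ge0.
  have V0 : 0 <= V by apply: sumr_ge0 => i _; rewrite mulr_ge0.
  have b0 := sphere_mean_ge0 n x f0.
  have a0 : 0 <= a.
    have : 0 <= n.+1%:R * a.
      rewrite aE; apply: sumr_ge0 => i _; apply: sumr_ge0 => v _.
      by rewrite mulr_ge0 // kexp_ge0 // => *; exact: sphere_density_ge0.
    by rewrite pmulr_rge0.
  have key : n%:R * sphere_mean n f x <= 6 * n%:R * a + 3 * U + V.
    have sm : \sum_(i < n.+1) sphere_mean i f x <= n.+1%:R * a + U.
      rewrite aE /U big_add1 /= big_mkord !big_ord_recl -addrA.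
      rewrite [walk 0 f x](_ : _ = sphere_mean 0 f x) ?lerD2l; last first.
        rewrite sphere_mean0 /walk (bigD1 x) //= eqxx mul1r big1 ?addr0 // => y yx.
        by rewrite eq_sym (negPf yx) mul0r.
      rewrite -big_split /=; apply: ler_sum => i _.
      by rewrite -lerBlDl ler_norm.
    have := @summation_by_parts_le R (fun i => sphere_mean i f x) n
      (fun i => sphere_mean_ge0 i x f0).
    rewrite -/V => h.
    have : n.+1%:R * a <= 2 * n%:R * a.
      by rewrite ler_wpM2r // -natrM ler_nat; move: n0; clear; lia.
    by lra.
  have n0' : 0 < n%:R ^+ 2 :> R by rewrite exprn_gt0 // ltr0n.
  rewrite -(ler_pM2l n0') -exprMn.
  apply: (@le_trans _ _ ((6 * n%:R * a + 3 * U + V) ^+ 2)).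
    by rewrite lerXn2r // nnegrE ?mulr_ge0 // !addr_ge0 ?mulr_ge0.
  apply: le_trans (sqr_sum3_le _ _ _) _.
  by rewrite !exprMn; lra.
apply: (@le_trans _ _ (\sum_x (108 * A x ^+ 2 + 27 * H x + 3 * G x))).
  by apply: ler_sum => x _.
rewrite !big_split /= -!mulr_sumr.
have hH : \sum_x H x <= 4 * \sum_x f x ^+ 2 by exact: sphere_mean_walk.
have hG : \sum_x G x <= 128 * \sum_x f x ^+ 2 by exact: sphere_mean_step2.
have hA : \sum_x A x ^+ 2 <= 32 * \sum_x f x ^+ 2.
  apply: (@maximal_ergodic R X t _ _ _ (fun x => (nu x).+1)) => //.
  - by move=> x y; exact: sphere_density_ge0.
  - by move=> x y; rewrite /t /conv -[RHS]sphere_densityN opprB.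
  - move=> x; rewrite -(@sphere_density_sum R M N d 1 d_gt0 M_gt0).
    by rewrite (reindex_inj (inv_inj (subKr x))); apply: eq_bigr => v _; rewrite /t /conv subKr.
(* The constants add up to 108 * 32 + 27 * 4 + 3 * 128 = 3948, below 64^2 = 4096. *)
have : 0 <= \sum_x f x ^+ 2 by apply: sumr_ge0 => x _; exact: sqr_ge0.
lra.
Qed.

End L2.

(** * The maximal inequality in l^p *)

(** Young's inequality with exponents q and q / (q - 1): the graph of a^q lies above its tangent at
    t. Averaged with t the mean, it gives Jensen's inequality. For q = 1 there is no finite
    conjugate exponent. *)
Lemma powR_tangent_le (R : realType) (q a t : R) : 1 <= q -> 0 <= a -> 0 <= t ->
  q * (a * t `^ (q - 1)) <= a `^ q + (q - 1) * t `^ q.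
Proof.
move=> q1 a0 t0; have [->|qn] := eqVneq q 1.
  by rewrite subrr powRr0 powRr1 // mul0r addr0 mul1r mulr1.
have {qn}q1' : 1 < q by rewrite lt_neqAle eq_sym qn.
have qB0 : 0 < q - 1 by rewrite subr_gt0.
have q0 : 0 < q by apply: lt_trans q1'.
have := @conjugate_powR R a (t `^ (q - 1)) q (q / (q - 1)) a0 (powR_ge0 _ _) q0
  (divr_gt0 q0 qB0).
have -> : q^-1 + (q / (q - 1))^-1 = 1 by field; rewrite !gt_eqF.
move=> /(_ erefl); rewrite -powRrM.
have -> : (q - 1) * (q / (q - 1)) = q by field; rewrite gt_eqF.
rewrite -(ler_pM2l q0); move/le_trans; apply.
rewrite le_eqVlt; apply/orP; left; apply/eqP; field; rewrite !gt_eqF //.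
Qed.

Lemma powR_jensen (R : realType) (I : finType) (w f : I -> R) (q : R) :
  1 <= q -> (forall i, 0 <= w i) -> \sum_i w i = 1 -> (forall i, 0 <= f i) ->
  (\sum_i w i * f i) `^ q <= \sum_i w i * f i `^ q.
Proof.
move=> q1 w0 w1 f0; set t := \sum_i w i * f i.
have t0 : 0 <= t by apply: sumr_ge0 => i _; exact: mulr_ge0.
have : \sum_i w i * (q * (f i * t `^ (q - 1))) <=
    \sum_i w i * (f i `^ q + (q - 1) * t `^ q).
  by apply: ler_sum => i _; rewrite ler_wpM2l // powR_tangent_le.
have -> : \sum_i w i * (q * (f i * t `^ (q - 1))) = q * t `^ q.
  rewrite -(mulr_powRB1 t0 (lt_le_trans ltr01 q1)).
  by rewrite {2}/t mulr_suml mulr_sumr; apply: eq_bigr => i _; ring.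
have -> : \sum_i w i * (f i `^ q + (q - 1) * t `^ q) =
    \sum_i w i * f i `^ q + (q - 1) * t `^ q.
  under eq_bigr do rewrite mulrDr.
  by rewrite big_split /= -mulr_suml w1 mul1r.
lra.
Qed.

Section Lp.
Context {R : realType} (M N : nat) {d : nat}.
Hypotheses (d_gt0 : (0 < d)%N) (M_gt0 : (0 < M)%N).
Local Notation X := 'rV['I_N.+2]_d.
Implicit Types (f : X -> R) (nu : X -> nat).

Let weight_sum n (x : X) : (n <= M)%N ->
  \sum_v conv (@sphere_density R M N d n) x v = 1.
Proof.
move=> nM; rewrite -(@sphere_density_sum R M N d n d_gt0 nM).
by rewrite (reindex_inj (inv_inj (subKr x))); apply: eq_bigr => v _; rewrite /conv subKr.
Qed.

Let weight_ge0 n (x v : X) : 0 <= conv (@sphere_density R M N d n) x v.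
Proof. exact: sphere_density_ge0. Qed.

Lemma sphere_mean_contraction n f : (n <= M)%N ->
  \sum_x sphere_mean M n f x ^+ 2 <= \sum_x f x ^+ 2.
Proof.
move=> nM.
apply: (@le_trans _ _ (\sum_x \sum_v conv (@sphere_density R M N d n) x v * f v ^+ 2)).
  apply: ler_sum => x _; apply: le_trans (cauchy_schwarz_weight _ _ _) _ => //.
  by rewrite weight_sum // mul1r.
rewrite exchange_big /=; apply: ler_sum => v _; rewrite -mulr_suml.
rewrite -[leRHS]mul1r ler_wpM2r ?sqr_ge0 // -(weight_sum v nM).
by apply: ler_sum => x _; rewrite /conv -sphere_densityN opprB.
Qed.

(** If [500 * M <= d] fails then M <= D, and the square at the chosen radius is at most the sum over
    all M + 1 radii, each mean being a contraction. *)
Lemma sphere_maximal_l2_all D nu f :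
  (500 * M <= d)%N || (M <= D)%N -> (forall x, (nu x <= M)%N) -> (forall x, 0 <= f x) ->
  \sum_x sphere_mean M (nu x) f x ^+ 2 <= (64 ^+ 2 + D.+1%:R) * \sum_x f x ^+ 2.
Proof.
move=> h nuM f0.
have F0 : 0 <= \sum_x f x ^+ 2 by apply: sumr_ge0 => x _; exact: sqr_ge0.
have [M_le|] := boolP (500 * M <= d)%N.
  apply: le_trans (sphere_maximal_l2 d_gt0 M_gt0 M_le nuM f0) _.
  by rewrite ler_wpM2r // lerDl.
move=> /negPf e; rewrite e /= in h.
apply: (@le_trans _ _ (M.+1%:R * \sum_x f x ^+ 2)); last first.
  rewrite ler_wpM2r //; apply: (@le_trans _ _ D.+1%:R); first by rewrite ler_nat.
  by rewrite lerDr sqr_ge0.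
apply: (@le_trans _ _ (\sum_x \sum_(n < M.+1) sphere_mean M n f x ^+ 2)).
  apply: ler_sum => x _; have nx : (nu x < M.+1)%N by rewrite ltnS.
  by rewrite (bigD1 (Ordinal nx)) //= lerDl sumr_ge0 // => n _; exact: sqr_ge0.
rewrite exchange_big /= mulr_natl -[M.+1 in leRHS]card_ord -sumr_const.
by apply: ler_sum => n _; apply: sphere_mean_contraction; rewrite -ltnS.
Qed.

(** By Jensen with exponent p / 2 >= 1, the power p / 2 of a mean is at most the mean of the power,
    so the l^2 bound for f^(p / 2) gives the same constant for every p. *)
Theorem sphere_maximal_lp D nu f p :
  2 <= p -> (500 * M <= d)%N || (M <= D)%N ->
  (forall x, (nu x <= M)%N) -> (forall x, 0 <= f x) ->
  \sum_x sphere_mean M (nu x) f x `^ p <= (64 ^+ 2 + D.+1%:R) * \sum_x f x `^ p.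
Proof.
move=> p2 h nuM f0; have p2' : 1 <= p / 2 by rewrite ler_pdivlMr // mul1r.
have E (a : R) : a `^ p = (a `^ (p / 2)) ^+ 2.
  by rewrite -powR_mulrn ?powR_ge0 // -powRrM divfK.
under [X in _ <= _ * X]eq_bigr do rewrite E.
under [X in X <= _]eq_bigr do rewrite E.
have f0' x : 0 <= f x `^ (p / 2) by exact: powR_ge0.
apply: le_trans (sphere_maximal_l2_all h nuM f0').
apply: ler_sum => x _; rewrite lerXn2r ?nnegrE ?powR_ge0 ?sphere_mean_ge0 //.
by apply: powR_jensen => //; exact: weight_sum.
Qed.

End Lp.

(** * Transference to Z^d *)

Section Lattice.
Context {R : realType} (M : nat) {d : nat}.
Local Notation J := 'I_(2 * M).+1.
Local Notation Y := {ffun 'I_d -> J}.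
Local Notation L := 'rV[int]_d.
Implicit Types (f a : L -> R) (x z : L) (y : Y) (P : pred Y).

Definition box_point y : L := \row_i centered (y i).

Lemma box_point_inj : injective box_point.
Proof.
move=> y y' /rowP h; apply/ffunP => i; apply: val_inj => /=.
by have := h i; rewrite !mxE /centered; lia.
Qed.

Lemma l1norm_intr z :
  l1norm (map_mx intr z) = (\sum_i `|z ord0 i|%N)%:R :> R.
Proof.
rewrite /l1norm natr_sum; apply: eq_bigr => i _.
by rewrite mxE -intr_norm -abszE.
Qed.

Lemma l1norm_box_point y : l1norm (map_mx intr (box_point y)) = (box_norm y)%:R :> R.
Proof. by rewrite l1norm_intr; congr (_%:R); apply: eq_bigr => i _; rewrite mxE. Qed.

Lemma box_point_surj z :
  l1norm (map_mx intr z) <= M%:R :> R -> exists y, box_point y = z.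
Proof.
move=> zM; have zi (k : 'I_1) i : (`|z k i| <= M)%N.
  rewrite -(ler_nat R); apply: le_trans zM; rewrite (ord1 k).
  rewrite /l1norm (bigD1 i) //= mxE -intr_norm -abszE lerDl.
  by apply: sumr_ge0.
exists [ffun i => inord `|(z ord0 i + M%:Z)%R|%N].
apply/matrixP => k i; rewrite mxE ffunE /centered.
rewrite inordK; last by have := zi ord0 i; lia.
have zk : z ord0 i = z k i by rewrite (ord1 k).
by have := zi ord0 i; lia.
Qed.

(** Replaces the sums over sets in the definition of [average] by sums over a finite type. *)
Lemma average_box (A : set 'rV[R]_d) P f x :
  (forall z, A (map_mx intr z) <-> exists2 y, P y & box_point y = z) ->
  average A f x = #|P|%:R^-1 * \sum_(y | P y) f (x - box_point y).
Proof.
move=> hA; pose s := [seq box_point y | y <- enum P].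
have us : uniq s by rewrite map_inj_uniq ?enum_uniq //; exact: box_point_inj.
have AE : lattice_points A = [set` s].
  apply/seteqP; split=> z /=.
    by move=> /hA[y Py <-]; apply/map_f; rewrite mem_enum.
  by move=> /mapP[y]; rewrite mem_enum => Py ->; apply/hA; exists y.
have fA : finite_set (lattice_points A) by rewrite AE; exact: finite_seq.
have ps : perm_eq (fset_set (lattice_points A)) s.
  apply: uniq_perm => // z; rewrite in_fset_set // AE.
  by apply/idP/idP; rewrite inE.
rewrite /average fsbig_finite //= (perm_big _ ps) big_map big_enum /=.
by rewrite (perm_size ps) size_map -cardE.
Qed.

Definition lattice_mean n a x : R :=
  (\sum_(y | box_norm y == n) a (x - box_point y)) / @sphere_count R M d n.

Lemma norm_sphere_average_le n f x : (n <= M)%N ->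
  `|sphere_average n f x| <= lattice_mean n (fun z => `|f z|) x.
Proof.
move=> nM; rewrite /sphere_average (@average_box _ [pred y | box_norm y == n]).
  rewrite /lattice_mean sphere_countE normrM ger0_norm ?invr_ge0 // mulrC.
  by rewrite ler_wpM2r ?invr_ge0 // ler_norm_sum.
move=> z; rewrite /l1sphere /=; split.
  move=> zn; have [|y yz] := @box_point_surj z; first by rewrite zn ler_nat.
  by exists y => //; rewrite /= -(eqr_nat R) -l1norm_box_point yz zn.
by move=> [y /eqP <- <-]; exact: l1norm_box_point.
Qed.

(** The ball is partitioned into spheres, so its average is a convex combination of sphere
    averages. *)
Lemma norm_ball_average_le r f x c : (0 < d)%N -> 0 <= r -> r < M.+1%:R ->
  (forall n, (n <= M)%N -> lattice_mean n (fun z => `|f z|) x <= c) ->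
  `|ball_average r f x| <= c.
Proof.
move=> d0 r0 rM hc; pose P := [pred y : Y | (box_norm y)%:R <= r].
have PM y : P y -> (box_norm y < M.+1)%N.
  by move=> /= h; rewrite -(ltr_nat R) (le_lt_trans h).
rewrite /ball_average (@average_box _ P) => [|z]; last first.
  rewrite /l1ball /=; split.
    move=> zn; have [|y yz] := @box_point_surj z.
      by move: (le_lt_trans zn rM); rewrite l1norm_intr ler_nat ltr_nat ltnS.
    by exists y; rewrite //= -l1norm_box_point yz.
  by move=> [y yr <-]; rewrite l1norm_box_point.
have P0 : 0 < #|P|%:R :> R.
  rewrite ltr0n; apply/card_gt0P.
  have [|y y0] := @box_point_surj 0; first by rewrite l1norm_intr ler_nat big1 // => i _; rewrite mxE.
  exists y; rewrite inE /= -l1norm_box_point y0 l1norm_intr big1 // => i _.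
  by rewrite mxE.
rewrite normrM ger0_norm ?invr_ge0 // ler_pdivrMl //.
apply: le_trans (ler_norm_sum _ _ _) _.
(* [inord] returns the true norm only below M + 1, which [PM] ensures on the ball. *)
pose rad y : 'I_M.+1 := inord (box_norm y).
have radE y : P y -> forall n : 'I_M.+1, (rad y == n) = (box_norm y == n).
  by move=> Py n; rewrite -val_eqE /= inordK // PM.
rewrite (partition_big rad predT) //= -sum1_card natr_sum.
rewrite (partition_big rad predT) //= mulr_suml; apply: ler_sum => n _.
have nM : (n <= M)%N by rewrite -ltnS.
rewrite (eq_bigl (fun y => P y && (box_norm y == n))); last first.
  by move=> y; rewrite -[_ <= r]/(P y); case: (boolP (P y)) => // /radE ->.
rewrite [X in X * c](eq_bigl (fun y => P y && (box_norm y == n))); last first.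
  by move=> y; rewrite -[y \in P]/(P y); case: (boolP (P y)) => // /radE ->.
have [nr|nr] := boolP (n%:R <= r); last first.
  rewrite big_pred0 => [|y]; last by apply/negbTE; apply: contra nr => /andP[/= + /eqP <-].
  by rewrite big_pred0 ?mul0r // => y; apply/negbTE; apply: contra nr => /andP[/= + /eqP <-].
have Pn y : P y && (box_norm y == n) = (box_norm y == n).
  by rewrite /=; case: eqP => [->|]; rewrite ?andbF // nr.
rewrite (eq_bigl _ _ Pn) [X in X * c](eq_bigl _ _ Pn).
rewrite -natr_sum sum1_card -sphere_countE.
by have := hc _ nM; rewrite /lattice_mean ler_pdivrMr ?sphere_count_pos // mulrC.
Qed.

End Lattice.

Section Transfer.
Context {R : realType} (M B : nat) {d : nat}.
Local Notation N := (2 * (B + M))%N.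
Local Notation X := 'rV['I_N.+2]_d.
Local Notation L := 'rV[int]_d.
Implicit Types (a : L -> R) (x z : L) (u : X).

(* The shift by B + M avoids signed representatives of residues: it sends the box
   of radius B + M to [0, N]. *)
Definition embed z : X := \row_i (z ord0 i + (B + M)%:Z)%:~R.

Definition unembed u : L := \row_i ((u ord0 i : nat)%:Z - (B + M)%:Z).

Lemma embedK z : (forall i, (`|z ord0 i| <= B + M)%N) -> unembed (embed z) = z.
Proof.
move=> zB; apply/matrixP => k i; rewrite !mxE.
have -> : z k i = z ord0 i by rewrite (ord1 k).
have := zB i; set v := z _ _ => vB.
have -> : v + (B + M)%:Z = `|(v + (B + M)%:Z)%R|%N%:Z by lia.
by rewrite -pmulrn Zp_nat /= modn_small; lia.
Qed.

Lemma unembed_inj : injective unembed.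
Proof.
move=> u v /matrixP h; apply/matrixP => k i; apply: val_inj => /=.
have E w : w k i = w ord0 i :> 'I_N.+2 by rewrite (ord1 k).
by have := h ord0 i; rewrite !mxE !E; lia.
Qed.

Lemma embedB x y : embed (x - box_point y) = embed x - @box_proj M N d y.
Proof.
apply/rowP => i; rewrite !mxE -rmorphB /=; congr (_%:~R).
by rewrite addrAC.
Qed.

(** A shift by a box point moves a coordinate by at most M, so it stays within B + M, where
    [unembed] inverts [embed]: nothing wraps around the torus. *)
Lemma sphere_mean_embed a n x : (forall i, (`|x ord0 i| <= B)%N) ->
  sphere_mean M n (a \o unembed) (embed x) = lattice_mean M n a x.
Proof.
move=> xB; rewrite /sphere_mean sphere_op; congr (_ / _).
apply: eq_bigr => y _; rewrite -embedB /= embedK // => i.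
have E (v : int) : (`|v| <= B)%N -> (`|(v - centered (y i))%R| <= B + M)%N.
  by rewrite /centered; have := ltn_ord (y i); lia.
by rewrite !mxE; apply: E.
Qed.

(** The points of s embed injectively into the torus, and the left side is completed by nonnegative
    terms to a sum over the torus; s' lists representatives of all its points. *)
Lemma lattice_maximal_bounded (nu : L -> nat) a p D (s : seq L) :
  (0 < d)%N -> (0 < M)%N -> 2 <= p -> (500 * M <= d)%N || (M <= D)%N ->
  (forall x, (nu x <= M)%N) -> (forall x, 0 <= a x) ->
  uniq s -> (forall x, x \in s -> forall i, (`|x ord0 i| <= B)%N) ->
  exists2 s', uniq s' &
  \sum_(x <- s) lattice_mean M (nu x) a x `^ p <=
  (64 ^+ 2 + D.+1%:R) * \sum_(x <- s') a x `^ p.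
Proof.
move=> d0 M0 p2 hM nuM a0 us sB.
exists [seq unembed u | u <- enum X].
  by rewrite map_inj_uniq ?enum_uniq //; exact: unembed_inj.
rewrite big_map big_enum /=.
have sK x : x \in s -> unembed (embed x) = x.
  by move=> xs; apply: embedK => i; rewrite (leq_trans (sB x xs i)) // leq_addr.
have := @sphere_maximal_lp R M N d d0 M0 D (nu \o unembed) (a \o unembed) p p2 hM
  (fun u => nuM _) (fun u => a0 _).
apply: le_trans.
have us' : uniq (map embed s).
  by rewrite map_inj_in_uniq // => x y /sK {2}<- /sK {2}<- ->.
have -> : \sum_(x <- s) lattice_mean M (nu x) a x `^ p =
    \sum_(u <- map embed s)
      sphere_mean M ((nu \o unembed) u) (a \o unembed) u `^ p.
  rewrite big_map big_seq [RHS]big_seq; apply: eq_bigr => x xs /=.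
  by rewrite sK // sphere_mean_embed //; exact: sB.
rewrite big_uniq //= [leRHS](bigID (mem (map embed s))) /= lerDl.
by apply: sumr_ge0 => u _; exact: powR_ge0.
Qed.

End Transfer.

(** The maximal function appears only as some [Phi] dominated by sphere means at a chosen radius, so
    that spheres and balls are handled alike. Finite sets of points suffice for the norm, and the
    constant does not depend on the box that contains them. *)
Lemma lpnorm_lattice_mean_le (R : realType) (M D d : nat) (nu : 'rV[int]_d -> nat)
    (f : 'rV[int]_d -> R) (Phi : 'rV[int]_d -> \bar R) p :
  (0 < d)%N -> (0 < M)%N -> 2 <= p -> (500 * M <= d)%N || (M <= D)%N ->
  (forall x, (nu x <= M)%N) ->
  (forall x, 0 <= Phi x)%E ->
  (forall x, Phi x <= (lattice_mean M (nu x) (fun z => `|f z|) x)%:E)%E ->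
  (lpnorm p Phi <= (64 ^+ 2 + D.+1%:R)%:E * lpnorm p (EFin \o f))%E.
Proof.
move=> d0 M0 p2 hM nuM Phi0 Phile.
set K := 64 ^+ 2 + D.+1%:R; set I := (\esum_(x in [set: _]) poweR `|(EFin \o f) x|%E p)%E.
have K1 : 1 <= K.
  by rewrite /K -[leLHS]add0r lerD ?sqr_ge0 // ler1n.
have K0 : 0 <= K by apply: le_trans K1.
have I0 : (0 <= I)%E by apply: esum_ge0 => x _; exact: poweR_ge0.
have p0 : 0 < p by apply: lt_le_trans p2.
have hI : (\esum_(x in [set: _]) poweR `|Phi x|%E p <= K%:E * I)%E.
  apply: ge_ereal_sup => _ [A [fA _] <-]; rewrite fsbig_finite //=.
  set s := fset_set A.
  pose B := \max_(x <- s) \max_(i < d) `|x ord0 i|%N.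
  have sB x : x \in (s : seq _) -> forall i, (`|x ord0 i| <= B)%N.
    move=> xs i; apply: leq_trans (leq_bigmax_seq _ xs isT).
    exact: (leq_bigmax (F := fun i => `|x ord0 i|%N)).
  have [s' us' hs'] := @lattice_maximal_bounded R M B d nu (fun z => `|f z|) p D s
    d0 M0 p2 hM nuM (fun x => normr_ge0 _) (fset_uniq s) sB.
  apply: (@le_trans _ _ (\sum_(x <- s) (lattice_mean M (nu x) (fun z => `|f z|) x `^ p)%:E)%E).
    apply: lee_sum => x _; rewrite -poweR_EFin gee0_abs //.
    apply: gt0_ler_poweR => //; first exact: ltW.
    - by rewrite in_itv /= Phi0 leey.
    - by rewrite in_itv /= (le_trans (Phi0 x)) //= leey.
  rewrite sumEFin; apply: (@le_trans _ _ (K * \sum_(x <- s') `|f x| `^ p)%:E).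
    by rewrite lee_fin.
  rewrite EFinM lee_wpmul2l // ?lee_fin //; apply: esum_ge.
  exists [set` s']; first by split => //; exact: finite_seq.
  by rewrite -fsbig_seq // -sumEFin.
have pi0 : 0 <= p^-1 by rewrite invr_ge0 ltW.
(* Taking the p-th root keeps the constant: K >= 1 and 1 / p <= 1, so K^(1 / p) <= K. *)
apply: (@le_trans _ _ (poweR (K%:E * I) p^-1)).
  apply: gt0_ler_poweR => //.
  - by rewrite in_itv /= leey andbT; apply: esum_ge0 => x _; exact: poweR_ge0.
  - by rewrite in_itv /= leey andbT mule_ge0.
rewrite poweRM // poweR_EFin lee_wpmul2r ?poweR_ge0 // lee_fin ler1_powR //.
by rewrite invf_le1 // (le_trans _ p2) // ler1n.
Qed.

Theorem theorem1p15 (R : realType) (eps : R) (heps0 : 0 < eps) (heps1 : eps < 1) :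
  exists C : R, 0 < C /\
    (forall (d : nat) (p : R), (0 < d)%N -> 2 <= p ->
      forall f : 'rV[int]_d -> R, (lpnorm p (EFin \o f) < +oo)%E ->
        (lpnorm p (sphere_maximal [set r : R | (0 < r <= d%:R `^ (1 - eps))%R] f)
           <= C%:E * lpnorm p (EFin \o f))%E) /\
    (forall (d : nat) (p : R), (0 < d)%N -> 2 <= p ->
      forall f : 'rV[int]_d -> R, (lpnorm p (EFin \o f) < +oo)%E ->
        (lpnorm p (ball_maximal [set r : R | (0 < r <= d%:R `^ (1 - eps))%R] f)
           <= C%:E * lpnorm p (EFin \o f))%E).
Proof.
have [c [c0 cE]] : exists c : R, 0 < c /\ c = 500%:R by exists 500%:R; rewrite ltr0n.
(* The threshold: if d^eps >= 500 then 500 M <= d^eps d^(1 - eps) = d; otherwise M <= d < 500^(1 /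
   eps), so M is bounded in terms of eps. *)
pose D := Num.truncn (c `^ eps^-1).
pose M d := Num.truncn (d%:R `^ (1 - eps) : R).
have eps1 : 0 <= 1 - eps by rewrite subr_ge0 ltW.
have rad1 d : (0 < d)%N -> 1 <= d%:R `^ (1 - eps) :> R.
  by move=> d0; rewrite -[leLHS](powRr0 d%:R) ler_powR // ler1n.
have M0 d : (0 < d)%N -> (0 < M d)%N by move=> d0; rewrite truncn_gt0 rad1.
have MD d : (0 < d)%N -> (500 * M d <= d)%N || (M d <= D)%N.
  move=> d0; have Md : (M d)%:R <= d%:R `^ (1 - eps) by rewrite truncn_le powR_ge0.
  have d1 : 1 <= d%:R :> R by rewrite ler1n.
  have [h|h] := leP c (d%:R `^ eps).
    apply/orP; left; rewrite -(ler_nat R) natrM -cE.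
    apply: (@le_trans _ _ (d%:R `^ eps * d%:R `^ (1 - eps))).
      exact: ler_pM (ltW c0) (ler0n _ _) h Md.
    rewrite -powRD ?subrKC ?powRr1 //.
    by rewrite gt_eqF ?implybT // ltr0n.
  apply/orP; right; rewrite truncn_ge_nat ?powR_ge0 //; apply: (le_trans Md).
  apply: (@le_trans _ _ d%:R).
    by rewrite -[leRHS]powRr1 // ler_powR // gerBl ltW.
  have -> : d%:R = (d%:R `^ eps) `^ eps^-1 :> R.
    by rewrite -powRrM divff ?gt_eqF // powRr1.
  by rewrite ge0_ler_powR ?invr_ge0 ?nnegrE ?powR_ge0 ?(ltW heps0) ?(ltW c0) ?(ltW h).
(* The supremum over the finitely many radii is attained, so a maximising radius at each x
   linearises it. *)
pose nu d (f : 'rV[int]_d -> R) x : nat :=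
  [arg max_(n > (ord0 : 'I_(M d).+1)) lattice_mean (M d) n (fun z => `|f z|) x]%O.
have nuM d f x : (@nu d f x <= M d)%N by rewrite -ltnS; exact: ltn_ord.
have nu_max d f x n : (n <= M d)%N ->
    lattice_mean (M d) n (fun z => `|f z|) x <=
    lattice_mean (M d) (@nu d f x) (fun z => `|f z|) x.
  rewrite -ltnS => nM; rewrite /nu; case: arg_maxP => // i _ /(_ (Ordinal nM)).
  exact.
exists (64 ^+ 2 + D.+1%:R); split; first by rewrite ltr_wpDl ?sqr_ge0 ?ltr0n.
(* The radius 1 is always admissible, so the suprema are over nonempty sets and are nonnegative
   rather than [-oo]. *)
have one d : (0 < d)%N -> [set r : R | 0 < r <= d%:R `^ (1 - eps)] 1%:R.
  by move=> d0 /=; rewrite ltr01 rad1.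
split=> d p d0 p2 f _; apply: (lpnorm_lattice_mean_le (nu := @nu d f) d0 (M0 d d0) p2 (MD d d0)) => // x.
- apply: (@le_trans _ _ `|sphere_average 1 f x|%:E); first by rewrite lee_fin.
  by apply: ereal_sup_ubound; exists 1%N => //; exact: one.
- apply: ge_ereal_sup => _ [n /= /andP[_ nr] <-].
  have nM : (n <= M d)%N by rewrite truncn_ge_nat ?powR_ge0.
  by rewrite lee_fin (le_trans (norm_sphere_average_le _ _ nM)) // nu_max.
- apply: (@le_trans _ _ `|ball_average 1%:R f x|%:E); first by rewrite lee_fin.
  by apply: ereal_sup_ubound; exists 1%:R => //; exact: one.
- apply: ge_ereal_sup => _ [r /= /andP[r0 hr] <-]; rewrite lee_fin.
  apply: (@norm_ball_average_le _ (M d)) => //; first exact: ltW.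
    by apply: (le_lt_trans hr); rewrite real_truncnS_gt ?num_real.
  by move=> n nM; exact: nu_max.
Qed.
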